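(* Let $(G,<,\cdot)$ be an infinite ordered group that is decomposable (in an ambient structure $\mathcal C$). Then there is an infinite convex normal o-minimal subgroup $H\unlhd G$.
   Context: $\mathcal C$ is an ambient first-order structure; ''definable'' means definable in $\mathcal C$. $(G,<,\cdot)$ is definable in $\mathcal C$, and an ordered group is a group with a linear order invariant under left and right translations. A pair $(X,<_X)$ of a definable set and a definable linear order on it is o-minimal if every definable subset of $X$ is a finite union of open $<_X$-intervals and points. A definable subgroup $H$ of $G$ is o-minimal if $(H,<)$ is o-minimal. A definable linearly ordered set $(X,<)$ is decomposable if there are definable equivalence relations $E_1,\dots,E_n$ on $X$ such that: (i) $E_1$ has finitely many classes; (ii) for $1\le i\le n-1$, $E_{i+1}$ refines $E_i$; (iii) for each $i<n$ there is a definable linear order $<_i$ on the set of $E_{i+1}$-classes such that for every $w\in X$ the set $\{[x]_{E_{i+1}} : E_i(x,w)\}$ ordered by $<_i$ is a dense o-minimal set; (iv) for every $w\in X$, the class $[w]_{E_n}$ ordered by $<$ is a dense o-minimal set. A finite set is decomposable, with the empty sequence of equivalence relations. An ordered group is decomposable if its underlying ordered set is. *)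

(* Defs.v *)
From mathcomp Require Import all_boot.
From mathcomp Require Import boolp classical_sets functions cardinality.

Set Implicit Arguments.
Unset Strict Implicit.
Unset Printing Implicit Defensive.

Local Open Scope classical_set_scope.

(** * First-order structures and definability *)

Record signature := Signature {
  fsym : Type;
  farity : fsym -> nat;
  rsym : Type;
  rarity : rsym -> nat }.

Record structure (L : signature) := Structure {
  carrier :> Type;
  fun_interp : forall f : fsym L, (farity f).-tuple carrier -> carrier;
  rel_interp : forall r : rsym L, (rarity r).-tuple carrier -> Prop }.

Inductive term (L : signature) : Type :=
| Var of nat
| App (f : fsym L) of ('I_(farity f) -> term L).

Inductive formula (L : signature) : Type :=
| Equal of term L & term L
| Rel (r : rsym L) of ('I_(rarity r) -> term L)
| Bot
| Imp of formula L & formula L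
| Forall of nat & formula L.

Section Definability.
Variables (L : signature) (C : structure L).

Fixpoint eval (s : nat -> C) (t : term L) : C :=
  match t with
  | Var i => s i
  | App f args => fun_interp [tuple eval s (args i) | i < farity f]
  end.

Definition update (s : nat -> C) (i : nat) (a : C) : nat -> C :=
  fun j => if j == i then a else s j.

(* The remaining connectives and the existential quantifier are classically
   expressible from those of [formula]. *)
Fixpoint sat (s : nat -> C) (phi : formula L) : Prop :=
  match phi with
  | Equal t u => eval s t = eval s u
  | Rel r args => rel_interp [tuple eval s (args i) | i < rarity r]
  | Bot => False
  | Imp phi psi => sat s phi -> sat s psi
  | Forall i phi => forall a : C, sat (update s i a) phi
  end.

(* The variables [0, ..., k - 1] stand for the coordinates of [x]; the other
   ones carry parameters, of which a formula uses only finitely many.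
   Definability is thus with parameters. *)
Definition assign k (s : nat -> C) (x : k.-tuple C) : nat -> C :=
  fun i => nth (s i) x i.

Definition definable k (A : set (k.-tuple C)) : Prop :=
  exists (phi : formula L) (s : nat -> C), A = [set x | sat (assign s x) phi].

Definition definable_rel k (X : set (k.-tuple C))
    (R : k.-tuple C -> k.-tuple C -> Prop) : Prop :=
  definable [set z : (k + k).-tuple C |
    exists x y, [/\ X x, X y, R x y & z = [tuple of x ++ y]]].

Definition definable_op k (X : set (k.-tuple C))
    (op : k.-tuple C -> k.-tuple C -> k.-tuple C) : Prop :=
  definable [set z : (k + k + k).-tuple C |
    exists x y, [/\ X x, X y & z = [tuple of (x ++ y) ++ op x y]]].

(* A set of pairwise disjoint classes is definable in the quotient when its
   preimage, i.e. its union, is definable. *)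
Definition definable_classes k (S : set (set (k.-tuple C))) : Prop :=
  definable (\bigcup_(c in S) c).

End Definability.

(** * Linear orders and o-minimality *)

Section Orders.
Variable T : Type.
Implicit Types (X A : set T) (lt : T -> T -> Prop).

Record linear_order_on X lt : Prop := LinearOrderOn {
  lin_irr : forall x, X x -> ~ lt x x;
  lin_trans : forall x y z, X x -> X y -> X z -> lt x y -> lt y z -> lt x z;
  lin_total : forall x y, X x -> X y -> [\/ lt x y, x = y | lt y x] }.

(* A one-element order is dense. *)
Definition dense_order X lt : Prop :=
  forall x y, X x -> X y -> lt x y -> exists z, [/\ X z, lt x z & lt z y].

(* [None] stands for -oo as a lower bound and for +oo as an upper bound. *)
Definition open_interval X lt (a b : option T) : set T :=
  [set x | [/\ X x, (if a is Some a' then lt a' x else True)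
                  & (if b is Some b' then lt x b' else True)]].

Definition endpoint X (a : option T) : Prop := if a is Some a' then X a' else True.

Definition interval_or_point X lt A : Prop :=
  (exists a b, [/\ endpoint X a, endpoint X b & A = open_interval X lt a b])
  \/ (exists2 a, X a & A = [set a]).

Definition finite_union_of_intervals_and_points X lt A : Prop :=
  exists F : set (set T),
    [/\ finite_set F, (forall B, F B -> interval_or_point X lt B)
      & A = \bigcup_(B in F) B].

(* [Def] is the class of definable sets: [@definable L C k] for sets of tuples,
   [@definable_classes L C k] for sets of equivalence classes. *)
Definition o_minimal (Def : set (set T)) X lt : Prop :=
  [/\ Def X, linear_order_on X lt
    & forall A, Def A -> A `<=` X -> finite_union_of_intervals_and_points X lt A].

Record equivalence_on X (E : T -> T -> Prop) : Prop := EquivalenceOn {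
  eqv_refl : forall x, X x -> E x x;
  eqv_sym : forall x y, X x -> X y -> E x y -> E y x;
  eqv_trans : forall x y z, X x -> X y -> X z -> E x y -> E y z -> E x z }.

Definition class_of X (E : T -> T -> Prop) (w : T) : set T :=
  [set x | X x /\ E x w].

Definition classes X (E : T -> T -> Prop) : set (set T) := class_of X E @` X.

End Orders.

(** * Decomposable ordered sets *)

Section Decomposable.
Variables (L : signature) (C : structure L) (k : nat).
Local Notation T := (k.-tuple C).
Implicit Types (X : set T) (lt : T -> T -> Prop).

(* Indices are shifted by one: [E 0, ..., E n] are the n + 1 equivalence
   relations, and [ltq i] orders the set of [E i.+1]-classes. *)
Record decomposition X lt (n : nat) (E : nat -> T -> T -> Prop)
    (ltq : nat -> set T -> set T -> Prop) : Prop := Decomposition {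
  dec_eqv : forall i, i <= n -> equivalence_on X (E i);
  dec_def : forall i, i <= n -> definable_rel X (E i);
  dec_finite : finite_set (classes X (E 0));
  dec_refine : forall i, i < n ->
    forall x y, X x -> X y -> E i.+1 x y -> E i x y;
  dec_ltq_lin : forall i, i < n -> linear_order_on (classes X (E i.+1)) (ltq i);
  dec_ltq_def : forall i, i < n ->
    definable_rel X
      (fun x y => ltq i (class_of X (E i.+1) x) (class_of X (E i.+1) y));
  dec_quotient : forall i, i < n -> forall w, X w ->
    let Q := class_of X (E i.+1) @` class_of X (E i) w in
    dense_order Q (ltq i) /\ o_minimal (@definable_classes L C k) Q (ltq i);
  dec_class : forall w, X w ->
    let Q := class_of X (E n) w in
    dense_order Q lt /\ o_minimal (@definable L C k) Q lt }.

Definition decomposable X lt : Prop :=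
  finite_set X \/ exists n E ltq, decomposition X lt n E ltq.

End Decomposable.

(** * Ordered groups on a set *)

Section Groups.
Variable T : Type.
Implicit Types (G H : set T) (lt : T -> T -> Prop).
Implicit Types (mul : T -> T -> T) (e : T) (inv : T -> T).

Record group_on G mul e inv : Prop := GroupOn {
  grp_mul : forall x y, G x -> G y -> G (mul x y);
  grp_one : G e;
  grp_inv : forall x, G x -> G (inv x);
  grp_assoc : forall x y z, G x -> G y -> G z ->
    mul x (mul y z) = mul (mul x y) z;
  grp_mul1 : forall x, G x -> mul e x = x /\ mul x e = x;
  grp_mulV : forall x, G x -> mul (inv x) x = e /\ mul x (inv x) = e }.

Record ordered_group_on G lt mul e inv : Prop := OrderedGroupOn {
  ogrp_group : group_on G mul e inv;
  ogrp_order : linear_order_on G lt;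
  ogrp_left : forall x y z, G x -> G y -> G z ->
    lt x y -> lt (mul z x) (mul z y);
  ogrp_right : forall x y z, G x -> G y -> G z ->
    lt x y -> lt (mul x z) (mul y z) }.

Record subgroup_of G mul e inv H : Prop := SubgroupOf {
  sgrp_sub : H `<=` G;
  sgrp_one : H e;
  sgrp_mul : forall x y, H x -> H y -> H (mul x y);
  sgrp_inv : forall x, H x -> H (inv x) }.

Record normal_subgroup_of G mul e inv H : Prop := NormalSubgroupOf {
  nsgrp_subgroup : subgroup_of G mul e inv H;
  nsgrp_conj : forall g h, G g -> H h -> H (mul (mul g h) (inv g)) }.

Definition convex_in G lt H : Prop :=
  forall x y z, H x -> G y -> H z -> lt x y -> lt y z -> H y.

End Groups.

(* Main.v *)
(* Let H be a minimal nontrivial definable convex subgroup of G.  It exists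
   since a strictly descending chain of definable convex subgroups has bounded
   length: if V > W then V/W is infinite, so some chain occurring in the
   decomposition separates infinitely many W-cosets in V, and n such steps make
   G n-dimensional.  The dimension theory cannot use uniform finiteness (C is
   arbitrary); it rests on a Fubini property of o-minimal chains: if S is a
   definable subset of I x J with S_x infinite for infinitely many x, then some
   S^t is infinite.  The same property yields the monotonicity theorem.

   H is normal since convex subgroups are comparable.  It is o-minimal: an
   infinite definable subset of H contains the image of an increasing map f
   defined on a chain, and the g with f(s) g^(+-1) < f(t) for all s < t form a
   convex subgroup, which is trivial by minimality.  By monotonicity f then has
   no gaps somewhere, which gives an o-minimal interval ]1, r[.  A definable
   subset of H with infinite boundary would give an f for which r is in that
   subgroup, and a definable cut of H without endpoint would have a proper
   stabilizer containing r. *)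
Require Import Defs.
From Stdlib Require List.
From mathcomp Require Import all_boot.
From mathcomp Require Import boolp classical_sets functions cardinality.

Set Implicit Arguments.
Unset Strict Implicit.
Unset Printing Implicit Defensive.

Local Open Scope classical_set_scope.

(** Quotients by the [E i] are only interpretable, so the arguments run over an abstract system of
    definable predicates ([defsys]) and over sorts whose elements are coded by tuples.

    Infinite is replaced by [big]: containing a nonempty interval. For definable subsets of a chain
    the two agree, but [big] is first-order, hence meaningful inside definable families whose finite
    members have no common bound.

    Dimension is measured by a list of charts, one for each step V > W of a chain of subgroups, by
    nesting [big] along the list. Passing to a suitable fibre of a chain of the decomposition costs
    one chart, and on a single point no chart survives; this is the origin of the bound [n.+1].

    Minimality enters through one mechanism: a definable convex subgroup inside V with a nontrivial
    element is V. It is applied to subgroups built from other data, the gaps of an increasing map or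
    the stabilizer of a cut, and an explicit element of V then refutes equality. *)

Section Renaming.
Variables (L : signature) (C : structure L).

Fixpoint rename_term (r : nat -> nat) (t : term L) : term L :=
  match t with
  | Var i => Var L (r i)
  | App f args => App (fun i => rename_term r (args i))
  end.

(** Bound variables are renamed too: for an injective [r] no capture can occur, so fresh variables
    never have to be chosen. *)
Fixpoint rename (r : nat -> nat) (phi : formula L) : formula L :=
  match phi with
  | Equal t u => Equal (rename_term r t) (rename_term r u)
  | Rel R args => Rel (fun i => rename_term r (args i))
  | Bot => Bot L
  | Imp phi psi => Imp (rename r phi) (rename r psi)
  | Forall i phi => Forall (r i) (rename r phi)
  end.

Lemma eval_rename r (s : nat -> C) t :
  eval s (rename_term r t) = eval (s \o r) t.
Proof.
elim: t => [i|f args IH] //=; congr fun_interp.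
by apply: eq_mktuple => i; exact: IH.
Qed.

Lemma update_rename r (s : nat -> C) i a : injective r ->
  update s (r i) a \o r = update (s \o r) i a.
Proof. by move=> rI; apply/funext => j; rewrite /update /= (inj_eq rI). Qed.

Lemma sat_rename r phi (s : nat -> C) : injective r ->
  sat s (rename r phi) <-> sat (s \o r) phi.
Proof.
move=> rI; elim: phi s => [t u|R args||phi IHphi psi IHpsi|i phi IH] s /=.
- by rewrite !eval_rename.
- suff -> : [tuple eval s (rename_term r (args i)) | i < rarity R] =
      [tuple eval (s \o r) (args i) | i < rarity R] by [].
  by apply: eq_mktuple => i; exact: eval_rename.
- by [].
- by rewrite IHphi IHpsi.
- split=> H a; first by rewrite -update_rename // -IH.
  by rewrite IH update_rename.
Qed.

Fixpoint forall_vars (l : seq nat) (phi : formula L) : formula L :=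
  if l is i :: l' then Forall i (forall_vars l' phi) else phi.

Lemma sat_forall_vars l phi (s : nat -> C) :
  sat s (forall_vars l phi) <->
  (forall s', (forall i, i \notin l -> s' i = s i) -> sat s' phi).
Proof.
elim: l s => [|i l IH] s /=.
  split=> [H s' Hs'|H]; last exact: H.
  by have -> : s' = s by apply/funext => i; exact: Hs'.
split=> [H s' Hs'|H a].
  have /IH := H (s' i); apply=> j jl; rewrite /update.
  by case: eqVneq => [->//|ji]; apply: Hs'; rewrite inE negb_or ji.
apply/IH => s' Hs'; apply: H => j; rewrite inE negb_or => /andP[ji jl].
by rewrite Hs' // /update (negPf ji).
Qed.

End Renaming.

(** * Definability systems *)

Definition shift T (v : nat -> T) : nat -> T := fun i => v i.+1.
Arguments shift T v i /.

(** Predicates depend on a whole sequence of variables, and quantifiers bind variable 0 in de Bruijn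
    style. Renamings are injective, as for formulas; identification of variables is recovered from
    equality and quantifiers. *)
Record defsys (T : Type) := DefSys {
  dfn : ((nat -> T) -> Prop) -> Prop;
  dfn_false : dfn (fun=> False);
  dfn_imp : forall P Q, dfn P -> dfn Q -> dfn (fun v => P v -> Q v);
  dfn_allT : forall P : (nat -> T) -> T -> Prop,
    dfn (fun v => P (shift v) (v 0)) -> dfn (fun v => forall x, P v x);
  dfn_ren : forall (r : nat -> nat) P, injective r ->
    dfn P -> dfn (fun v => P (v \o r));
  dfn_eqvar : forall i j, dfn (fun v => v i = v j);
  dfn_eqcst : forall i c, dfn (fun v => v i = c) }.

(** * Formulas with parameters as a definability system *)

Section Formulas.
Variables (L : signature) (C : structure L) (k : nat).
Hypothesis k_gt0 : 0 < k.
Local Notation T := (k.-tuple C).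
Implicit Types (v : nat -> T) (s : nat -> C).

(* Even variables carry the coordinates of [v 0], [v 1], ... one after the
   other, odd ones the parameters. *)
Definition flat v s : nat -> C :=
  fun i => if odd i then s i./2
           else tnth (v (i./2 %/ k)) (Ordinal (ltn_pmod i./2 k_gt0)).

Definition fdfn (P : (nat -> T) -> Prop) : Prop :=
  exists phi s, forall v, P v <-> sat (flat v s) phi.

Lemma flat_even v s m :
  flat v s m.*2 = tnth (v (m %/ k)) (Ordinal (ltn_pmod m k_gt0)).
Proof.
by rewrite /flat odd_double; move: (ltn_pmod m.*2./2 k_gt0); rewrite doubleK => p;
  congr tnth; apply: val_inj.
Qed.

Lemma flat_nth c v s m : flat v s m.*2 = nth c (v (m %/ k)) (m %% k).
Proof. by rewrite flat_even (tnth_nth c). Qed.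

Lemma flat_odd v s m : flat v s m.*2.+1 = s m.
Proof. by rewrite /flat /= odd_double /= uphalf_double. Qed.

Lemma odd_even_ext (f g : nat -> C) :
  (forall m, f m.*2 = g m.*2) -> (forall m, f m.*2.+1 = g m.*2.+1) -> f = g.
Proof.
move=> H0 H1; apply/funext => i; rewrite -(odd_double_half i).
by case: (odd i); rewrite ?add0n ?add1n.
Qed.

Definition ren2 (f g : nat -> nat) i :=
  if odd i then (g i./2).*2.+1 else (f i./2).*2.

Lemma ren2_even f g m : ren2 f g m.*2 = (f m).*2.
Proof. by rewrite /ren2 odd_double doubleK. Qed.

Lemma ren2_odd f g m : ren2 f g m.*2.+1 = (g m).*2.+1.
Proof. by rewrite /ren2 /= odd_double /= uphalf_double. Qed.

Lemma ren2_inj f g : injective f -> injective g -> injective (ren2 f g).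
Proof.
move=> fI gI i j; rewrite -(odd_double_half i) -(odd_double_half j).
case: (odd i); case: (odd j); rewrite ?add0n ?add1n ?ren2_odd ?ren2_even.
- by case=> /double_inj/gI ->.
- by move/(congr1 odd); rewrite /= !odd_double.
- by move/(congr1 odd); rewrite /= !odd_double.
- by move/double_inj/fI => ->.
Qed.

Lemma fdfn_params (g : nat -> nat) phi s s' : injective g ->
  (forall m, s' (g m) = s m) ->
  forall v, sat (flat v s') (rename (ren2 id g) phi) <-> sat (flat v s) phi.
Proof.
move=> gI Hs v; rewrite sat_rename; last exact: ren2_inj.
suff -> : flat v s' \o ren2 id g = flat v s by [].
by apply: odd_even_ext => m /=; rewrite ?ren2_even ?ren2_odd ?flat_even ?flat_odd.
Qed.

Lemma fdfn_false (c : C) : fdfn (fun=> False).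
Proof. by exists (Bot L), (fun=> c). Qed.

Lemma fdfn_imp P Q : fdfn P -> fdfn Q -> fdfn (fun v => P v -> Q v).
Proof.
move=> [phi [s Hs]] [psi [t Ht]].
(* Both formulas share one parameter sequence: [s] at even places, [t] at odd ones. *)
pose u i := if odd i then t i./2 else s i./2.
exists (Imp (rename (ren2 id double) phi)
            (rename (ren2 id (fun m => m.*2.+1)) psi)), u => v /=.
rewrite (@fdfn_params _ _ s) ?(@fdfn_params _ _ t) ?Hs ?Ht //.
- by move=> i j [] /double_inj.
- by move=> m; rewrite /u /= odd_double /= uphalf_double.
- exact: double_inj.
- by move=> m; rewrite /u odd_double doubleK.
Qed.

Lemma fdfn_ren (r : nat -> nat) P : injective r ->
  fdfn P -> fdfn (fun v => P (v \o r)).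
Proof.
move=> rI [phi [s Hs]].
pose f m := r (m %/ k) * k + m %% k.
have fdiv m : f m %/ k = r (m %/ k).
  by rewrite /f divnMDl // [_ %% k %/ k]divn_small ?addn0 //; exact: ltn_pmod.
have fmod m : f m %% k = m %% k by rewrite /f modnMDl modn_mod.
exists (rename (ren2 f id) phi), s => v; rewrite Hs sat_rename; last first.
  apply: ren2_inj => // m m' E; rewrite (divn_eq m k) (divn_eq m' k).
  by rewrite -(fmod m) -(fmod m') -(rI _ _ (etrans (esym (fdiv m)) (etrans (congr1 (divn^~ k) E) (fdiv m')))) E.
suff -> : flat v s \o ren2 f id = flat (v \o r) s by [].
apply: odd_even_ext => m /=; rewrite ?ren2_even ?ren2_odd ?flat_odd //.
rewrite !flat_even fdiv /=; congr tnth; apply: val_inj => /=; exact: fmod.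
Qed.

Lemma fdfn_allT (P : (nat -> T) -> T -> Prop) :
  fdfn (fun v => P (shift v) (v 0)) -> fdfn (fun v => forall x, P v x).
Proof.
move=> [phi [s Hs]].
(* The coordinates of [v 0] are moved to the first [k] parameters. *)
pose r i := if odd i then (i./2 + k).*2.+1
            else if i./2 < k then i./2.*2.+1 else (i./2 - k).*2.
have re m : r m.*2 = if m < k then m.*2.+1 else (m - k).*2.
  by rewrite /r odd_double doubleK.
have ro m : r m.*2.+1 = (m + k).*2.+1.
  by rewrite /r /= odd_double /= uphalf_double.
have rI : injective r.
  move=> i j; rewrite -(odd_double_half i) -(odd_double_half j).
  case: (odd i); case: (odd j); rewrite ?add0n ?add1n ?ro ?re.
  - by case=> /double_inj/addIn ->.
  - case: ltnP => [jk|_] [].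
      by move/double_inj => E; move: jk; rewrite -E ltnNge leq_addl.
    by move/(congr1 odd); rewrite /= !odd_double.
  - case: ltnP => [ik|_] [].
      by move/double_inj => E; move: ik; rewrite E ltnNge leq_addl.
    by move/(congr1 odd); rewrite /= !odd_double.
  - case: ltnP => ik; case: ltnP => jk.
    + by case=> /double_inj ->.
    + by move/(congr1 odd); rewrite /= !odd_double.
    + by move/(congr1 odd); rewrite /= !odd_double.
    + by move/double_inj/eqP; rewrite eqn_sub2rE // => /eqP ->.
(* Places below [k] hold a dummy value: they are quantified over. *)
pose s' j := s (j - k).
exists (forall_vars [seq m.*2.+1 | m <- iota 0 k] (rename r phi)), s' => v.
have key (x : T) (w : nat -> C) :
    (forall m (mk : m < k), w m.*2.+1 = tnth x (Ordinal mk)) ->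
    (forall i, i \notin [seq m.*2.+1 | m <- iota 0 k] -> w i = flat v s' i) ->
    w \o r = flat (fun i => if i is i'.+1 then v i' else x) s.
  move=> wx wv; apply: odd_even_ext => m /=.
    pose c := tnth x (Ordinal k_gt0).
    rewrite re (flat_nth c); case: ltnP => mk.
      by rewrite (wx _ mk) divn_small // modn_small // (tnth_nth c).
    rewrite wv; last first.
      by apply/mapP => -[j _ /(congr1 odd)]; rewrite /= !odd_double.
    rewrite (flat_nth c) -{3 4}(subnK mk) modnDr divnDr ?dvdnn // divnn k_gt0.
    by rewrite addn1.
  rewrite ro flat_odd wv; last first.
    apply/mapP => -[j]; rewrite mem_iota /= add0n => jk [] /double_inj E.
    by move: jk; rewrite -E ltnNge leq_addl.
  by rewrite flat_odd /s' addnK.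
rewrite sat_forall_vars; split=> [H w Hw|H x].
  rewrite sat_rename //.
  pose x : T := [tuple w (i : nat).*2.+1 | i < k].
  rewrite (key x) //; last by move=> m mk; rewrite tnth_mktuple.
  rewrite -Hs; exact: H.
pose c := tnth x (Ordinal k_gt0).
pose w i := if odd i && (i./2 < k) then nth c x i./2 else flat v s' i.
have wr i : i \notin [seq m.*2.+1 | m <- iota 0 k] -> w i = flat v s' i.
  rewrite /w; case: ifP => // /andP[oi ik]; case/negP; apply/mapP.
  exists i./2; first by rewrite mem_iota.
  by rewrite -[LHS]odd_double_half oi.
have := H w wr; rewrite sat_rename // (key x) => [H1||//].
  exact: (proj2 (Hs (fun i => if i is i'.+1 then v i' else x)) H1).
by move=> m mk; rewrite (tnth_nth c) /w /= odd_double uphalf_double mk.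
Qed.

Definition FTrue := Imp (Bot L) (Bot L).
Definition FAnd phi psi : formula L := Imp (Imp phi (Imp psi (Bot L))) (Bot L).

Lemma sat_FAnd s phi psi : sat s (FAnd phi psi) <-> sat s phi /\ sat s psi.
Proof.
rewrite /=; split=> [H|[H1 H2]]; last by move/(_ H1 H2).
by split; apply: contrapT => H1; apply: H => ? ?.
Qed.

Lemma fdfn_eqs (n : nat) (f g : nat -> nat) s :
  exists phi, forall v, (forall m, m < n -> flat v s (f m) = flat v s (g m)) <->
    sat (flat v s) phi.
Proof.
exists (foldr (fun m psi => FAnd (Equal (Var L (f m)) (Var L (g m))) psi)
          FTrue (iota 0 n)) => v.
suff H l : (forall m, m \in l -> flat v s (f m) = flat v s (g m)) <->
    sat (flat v s) (foldr (fun m psi =>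
      FAnd (Equal (Var L (f m)) (Var L (g m))) psi) FTrue l).
  rewrite -H; split=> H1 m; first by rewrite mem_iota => /H1.
  by move=> mn; apply: H1; rewrite mem_iota.
elim: l => [|m l IH]; first by split=> [_ []|_ m].
rewrite [foldr _ _ _]/= sat_FAnd -IH /=; split=> [H|[H1 H2] j].
  by split=> [|j jl]; apply: H; rewrite inE ?eqxx ?jl ?orbT.
by rewrite inE => /predU1P[->|/H2].
Qed.

Lemma fdfn_eqvar (c : C) i j : fdfn (fun v => v i = v j).
Proof.
have [phi Hs] := fdfn_eqs k (fun m => (i * k + m).*2)
  (fun m => (j * k + m).*2) (fun=> c).
exists phi, (fun=> c) => v; rewrite -Hs; split=> [E m mk|H].
  by rewrite !(flat_nth c) !divnMDl // !(divn_small mk) !addn0 !modnMDl E.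
apply: eq_from_tnth => m; have := H m (ltn_ord m).
rewrite !(flat_nth c) !divnMDl // !(divn_small (ltn_ord m)) !addn0 !modnMDl.
by rewrite modn_small // -!tnth_nth.
Qed.

Lemma fdfn_eqcst i (c : T) : fdfn (fun v => v i = c).
Proof.
pose d := tnth c (Ordinal k_gt0).
have [phi Hphi] := fdfn_eqs k (fun m => (i * k + m).*2)
  (fun m => m.*2.+1) (nth d c).
exists phi, (nth d c) => v; rewrite -Hphi; split=> [E m mk|H].
  by rewrite (flat_nth d) flat_odd divnMDl // (divn_small mk) addn0 modnMDl
    modn_small // E.
apply: eq_from_tnth => m; have := H m (ltn_ord m).
rewrite (flat_nth d) flat_odd divnMDl // (divn_small (ltn_ord m)) addn0 modnMDl.
by rewrite modn_small // -!tnth_nth.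
Qed.

Definition formula_defsys (c : C) : defsys T :=
  DefSys (fdfn_false c) fdfn_imp fdfn_allT fdfn_ren (fdfn_eqvar c) fdfn_eqcst.

Lemma sat_fdfn m phi s (h : (nat -> T) -> nat -> C) (P : (nat -> T) -> Prop) :
  (forall v i, i < m -> h v i = flat v s i.*2) ->
  (forall v, P v <-> sat (fun i => if i < m then h v i else s i) phi) ->
  fdfn P.
Proof.
move=> hE HP; pose r i := if i < m then i.*2 else i.*2.+1.
exists (rename r phi), s => v; rewrite HP sat_rename; last first.
  move=> i j; rewrite /r; case: ltnP => _; case: ltnP => _ H.
  - exact: double_inj.
  - by move/(congr1 odd): H; rewrite /= !odd_double.
  - by move/(congr1 odd): H; rewrite /= !odd_double.
  - by case: H => /double_inj.
suff -> : (fun i => if i < m then h v i else s i) = flat v s \o r by [].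
apply/funext => i; rewrite /r /=; case: ltnP => im; first exact: hE.
by rewrite flat_odd.
Qed.

Lemma definable_fdfn (A : set T) : definable A <-> fdfn (fun v => A (v 0)).
Proof.
split=> [[phi [s ->]]|[phi [s Hs]]].
  apply: (@sat_fdfn k phi s (fun v i => nth (s i) (v 0) i)) => [v i ik|v /=].
    rewrite flat_even divn_small // (tnth_nth (s i)) /=.
    by rewrite modn_small.
  suff -> : assign s (v 0) = fun i => if i < k then nth (s i) (v 0) i else s i
    by [].
  apply/funext => i; rewrite /assign; case: ltnP => // ki.
  by rewrite nth_default // size_tuple.
(* [phi] may mention [v 1], [v 2], ..., on which its truth value does not depend; setting them to
   [x0] turns them into parameters. *)
case: (pselect (exists x0 : T, True)) => [[x0 _]|H]; last first.
  by exists phi, s; apply/seteqP; split=> x; case: H; exists x.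
pose r i := if ~~ odd i && (i./2 < k) then i./2 else k + i.
have rI : injective r.
  move=> i j; rewrite /r; case: ifP => [/andP[oi ik]|_];
    case: ifP => [/andP[oj jk]|_].
  - by move=> E; rewrite -(even_halfK oi) -(even_halfK oj) E.
  - by move=> E; move: ik; rewrite E ltnNge leq_addr.
  - by move=> E; move: jk; rewrite -E ltnNge leq_addr.
  - by move/addnI.
exists (rename r phi), (fun i => flat (fun=> x0) s (i - k)).
have E x : assign (fun i => flat (fun=> x0) s (i - k)) x \o r =
    flat (fun i => if i is 0 then x else x0) s.
  apply/funext => i; rewrite /assign /r /=; case: ifP => [/andP[oi ik]|ik].
    rewrite -[in RHS](even_halfK oi) (flat_nth (tnth x0 (Ordinal k_gt0))) /=.
    rewrite divn_small // modn_small //; apply: set_nth_default.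
    by rewrite size_tuple.
  rewrite nth_default ?size_tuple ?leq_addr // addKn /flat.
  case: ifP => // oi; move: ik; rewrite oi /= => ik.
  case E: (i./2 %/ k) => //; move/eqP: E.
  by rewrite -leqn0 leqNgt divn_gt0 // leqNgt ik.
apply/seteqP; split=> x; rewrite /= sat_rename // E.
  by move=> Ax; apply/(Hs (fun i => if i is 0 then x else x0)).
by move/(Hs (fun i => if i is 0 then x else x0)).
Qed.

End Formulas.

(* A type whose elements are coded, not necessarily uniquely, by those of [T]:
   an interpretable set. *)
Record sort (T : Type) (D : defsys T) := Sort {
  elt :> Type;
  code : T -> elt;
  codeK : forall x, exists a, code a = x;
  code_eq : dfn D (fun v => code (v 0) = code (v 1)) }.

(** * Closure properties and substitution of definable terms *)

Section Closure.
Variables (T : Type) (D : defsys T).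
Implicit Types (P Q : (nat -> T) -> Prop).

Lemma dfn_ext P Q : (forall v, P v <-> Q v) -> dfn D P -> dfn D Q.
Proof. by move=> H; have -> : P = Q by apply/funext => v; apply/propext. Qed.

Lemma dfn_not P : dfn D P -> dfn D (fun v => ~ P v).
Proof. by move=> H; apply: dfn_imp => //; exact: dfn_false. Qed.

Lemma dfn_true : dfn D (fun=> True).
Proof.
by apply: dfn_ext (dfn_not (dfn_false D)) => v; split=> // _; case.
Qed.

Lemma dfn_cst (A : Prop) : dfn D (fun=> A).
Proof.
have [HA|HA] := pselect A; first by apply: dfn_ext dfn_true.
by apply: dfn_ext (dfn_false D).
Qed.

Lemma dfn_or P Q : dfn D P -> dfn D Q -> dfn D (fun v => P v \/ Q v).
Proof.
move=> HP HQ; apply: dfn_ext (dfn_imp (dfn_not HP) HQ) => v.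
split=> [H|[H|H] //]; have [p|p] := pselect (P v); by [left|right; exact: H].
Qed.

Lemma dfn_and P Q : dfn D P -> dfn D Q -> dfn D (fun v => P v /\ Q v).
Proof.
move=> HP HQ; apply: dfn_ext (dfn_not (dfn_or (dfn_not HP) (dfn_not HQ))) => v.
split=> [H|[p q] [|]//]; split; apply: contrapT => p; apply: H; tauto.
Qed.

Lemma dfn_iff P Q : dfn D P -> dfn D Q -> dfn D (fun v => P v <-> Q v).
Proof. by move=> HP HQ; apply: dfn_and; apply: dfn_imp. Qed.

Lemma dfn_exT (P : (nat -> T) -> T -> Prop) :
  dfn D (fun v => P (shift v) (v 0)) -> dfn D (fun v => exists x, P v x).
Proof.
move=> /dfn_not HP; apply: dfn_ext (dfn_not (@dfn_allT _ D (fun v x => ~ P v x) HP)).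
by move=> v; split=> [H|[x Px]]; [apply: contrapT => /forallNP|move/(_ x)].
Qed.

Implicit Types X Y Z : sort D.

Lemma dfn_all X (P : (nat -> T) -> X -> Prop) :
  dfn D (fun v => P (shift v) (code X (v 0))) -> dfn D (fun v => forall x, P v x).
Proof.
move/(@dfn_allT _ D (fun v a => P v (code X a))); apply: dfn_ext => v.
by split=> // H x; have [a <-] := codeK x.
Qed.

Lemma dfn_ex X (P : (nat -> T) -> X -> Prop) :
  dfn D (fun v => P (shift v) (code X (v 0))) -> dfn D (fun v => exists x, P v x).
Proof.
move/(@dfn_exT (fun v a => P v (code X a))); apply: dfn_ext => v.
by split=> [[a H]|[x]]; [exists (code X a)|have [a <-] := codeK x; exists a].
Qed.

(** Definable functions enter only through their graphs, with variable 0 carrying a code of the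
    value. *)
Definition dterm X (f : (nat -> T) -> X) : Prop :=
  dfn D (fun v => code X (v 0) = f (shift v)).
Definition dset X (A : X -> Prop) : Prop := dfn D (fun v => A (code X (v 0))).
Definition drel X Y (R : X -> Y -> Prop) : Prop :=
  dfn D (fun v => R (code X (v 0)) (code Y (v 1))).
Definition drel3 X Y Z (R : X -> Y -> Z -> Prop) : Prop :=
  dfn D (fun v => R (code X (v 0)) (code Y (v 1)) (code Z (v 2))).

Lemma dfn_lift P : dfn D P -> dfn D (fun v => P (shift v)).
Proof. by apply: (@dfn_ren _ D (fun i => i.+1)) => i j []. Qed.

Lemma dterm_lift X (f : (nat -> T) -> X) n : dterm f ->
  dfn D (fun v => code X (v n) = f (fun i => v (n + i.+1))).
Proof.
move=> /(@dfn_ren _ D (fun i => n + i)) H.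
by apply: dfn_ext (H (@addnI n)) => v /=; rewrite addn0.
Qed.

Lemma dterm_sub X (f : (nat -> T) -> X) n : dterm f ->
  dfn D (fun v => code X (v 0) = f (fun i => v (n + i.+1))).
Proof.
rewrite /dterm.
move=> /(@dfn_ren _ D (fun i => if i is 0 then 0 else n + i)) H.
apply: dfn_ext (H _) => [v|[|i] [|j]] //=.
- by rewrite addnS.
- by rewrite addnS.
- by move/addnI.
Qed.

Lemma dfn_set X (A : X -> Prop) f : dset A -> dterm f -> dfn D (fun v => A (f v)).
Proof.
move=> HA Hf.
apply: (@dfn_ext (fun v => exists a, code X a = f v /\ A (code X a))) => [v|].
  split=> [[a [<-]]//|H]; have [a E] := codeK (f v).
  by exists a; rewrite E.
apply: dfn_exT; apply: dfn_and; first exact: Hf.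
exact: HA.
Qed.

(** The terms may share variables while renamings must be injective, so the substitution goes
    through fresh codes bound by existential quantifiers. *)
Lemma dfn_rel X Y (R : X -> Y -> Prop) f g : drel R -> dterm f -> dterm g ->
  dfn D (fun v => R (f v) (g v)).
Proof.
move=> HR Hf Hg.
apply: (@dfn_ext (fun v => exists b a,
  [/\ code X a = f v, code Y b = g v & R (code X a) (code Y b)])) => [v|].
  split=> [[b [a [<- <-]]]//|H]; have [a Ea] := codeK (f v).
  by have [b Eb] := codeK (g v); exists b, a; rewrite Ea Eb.
apply: dfn_exT; apply: dfn_exT => /=.
apply: (@dfn_ext (fun v => (code X (v 0) = f (fun i => v i.+2) /\
  code Y (v 1) = g (fun i => v i.+2)) /\ R (code X (v 0)) (code Y (v 1)))).
  by move=> v; split=> [[[]]|[]].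
apply: dfn_and HR; apply: dfn_and; first exact: (dterm_sub 1 Hf).
exact: (dterm_lift 1 Hg).
Qed.

Lemma dfn_rel3 X Y Z (R : X -> Y -> Z -> Prop) f g h :
  drel3 R -> dterm f -> dterm g -> dterm h -> dfn D (fun v => R (f v) (g v) (h v)).
Proof.
move=> HR Hf Hg Hh.
apply: (@dfn_ext (fun v => exists c b a,
  [/\ code X a = f v, code Y b = g v, code Z c = h v
    & R (code X a) (code Y b) (code Z c)])) => [v|].
  split=> [[c [b [a [<- <- <-]]]]//|H]; have [a Ea] := codeK (f v).
  have [b Eb] := codeK (g v); have [c Ec] := codeK (h v).
  by exists c, b, a; rewrite Ea Eb Ec.
do 3!apply: dfn_exT => /=.
apply: (@dfn_ext (fun v => ((code X (v 0) = f (fun i => v i.+3) /\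
  code Y (v 1) = g (fun i => v i.+3)) /\ code Z (v 2) = h (fun i => v i.+3)) /\
   R (code X (v 0)) (code Y (v 1)) (code Z (v 2)))).
  by move=> v; split=> [[[[]]]|[]].
apply: dfn_and HR; apply: dfn_and; last exact: (dterm_lift 2 Hh).
apply: dfn_and; first exact: (dterm_sub 2 Hf).
have := dfn_lift (dterm_sub 1 Hg); exact: dfn_ext.
Qed.

Lemma dterm_var X i : dterm (fun v => code X (v i)).
Proof.
have := @dfn_ren _ D (fun j => if j is j'.+1 then i.+1 + j' else 0) _ _
  (code_eq X).
move=> H; apply: dfn_ext (H _) => [v|[|j] [|l]] //=; first by rewrite addn0.
by move/addnI => ->.
Qed.

Lemma dterm_cst X (x : X) : dterm (fun=> x).
Proof.
have [a <-] := codeK x; rewrite /dterm.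
apply: (@dfn_ext (fun v => exists b, b = a /\ code X (v 0) = code X b)) => [v|].
  by split=> [[b [->]]//|H]; exists a.
apply: dfn_exT; apply: dfn_and => /=; first exact: dfn_eqcst.
by apply: dfn_ext (code_eq X) => v; split=> ->.
Qed.

Lemma drel_eq X : drel (fun x y : X => x = y).
Proof. exact: code_eq. Qed.

Lemma dfn_eq X (f g : (nat -> T) -> X) :
  dterm f -> dterm g -> dfn D (fun v => f v = g v).
Proof. exact/dfn_rel/drel_eq. Qed.

Lemma dterm_fun X Y (F : X -> Y) f : drel (fun y x => y = F x) -> dterm f ->
  dterm (fun v => F (f v)).
Proof.
move=> HF Hf; apply: (dfn_rel HF); first exact: dterm_var.
exact: (dterm_sub 1 Hf).
Qed.

Lemma dterm_fun2 X Y Z (F : X -> Y -> Z) f g :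
  drel3 (fun z x y => z = F x y) -> dterm f -> dterm g ->
  dterm (fun v => F (f v) (g v)).
Proof.
move=> HF Hf Hg; apply: (dfn_rel3 HF); first exact: dterm_var.
  exact: (dterm_sub 1 Hf).
exact: (dterm_sub 1 Hg).
Qed.

End Closure.

Arguments dset {T D X} A.
Arguments drel {T D X Y} R.
Arguments drel3 {T D X Y Z} R.

(* Automatic proofs of definability *)
Create HintDb dfn.

Ltac dfn_rel_hyp := solve [eassumption | auto with dfn nocore | apply: drel_eq].

Ltac sort_of f := lazymatch type of f with _ -> elt ?X => X end.

Ltac dfn_term :=
  first [ apply: dterm_var | apply: dterm_cst
        | lazymatch goal with
          | |- dterm (fun v => ?F (@?f v) (@?g v)) =>
              refine (@dterm_fun2 _ _ _ _ _ F f g _ _ _);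
              [dfn_rel_hyp | dfn_term | dfn_term]
          end
        | lazymatch goal with
          | |- dterm (fun v => ?F (@?f v)) =>
              refine (@dterm_fun _ _ _ _ F f _ _); [dfn_rel_hyp | dfn_term]
          end ].

(** A relation must be the head of the atom, with its definability in the context or the hints.
    Compound relations are therefore named by [pose], and the goal is restated by [suff], before
    [definable] is called. *)
Ltac dfn_atom :=
  first [ apply: dfn_cst
        | lazymatch goal with
          | |- dfn _ (fun v => @eq _ (@?f v) (@?g v)) =>
              refine (@dfn_eq _ _ _ f g _ _); dfn_term
          end
        | lazymatch goal with
          | |- dfn _ (fun v => ?R (@?f v) (@?g v) (@?h v)) =>
              let X := sort_of f in let Y := sort_of g in let Z := sort_of h in
              refine (@dfn_rel3 _ _ X Y Z R f g h _ _ _ _);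
              [dfn_rel_hyp | dfn_term | dfn_term | dfn_term]
          end
        | lazymatch goal with
          | |- dfn _ (fun v => ?R (@?f v) (@?g v)) =>
              let X := sort_of f in let Y := sort_of g in
              refine (@dfn_rel _ _ X Y R f g _ _ _);
              [dfn_rel_hyp | dfn_term | dfn_term]
          end
        | lazymatch goal with
          | |- dfn _ (fun v => ?A (@?f v)) =>
              let X := sort_of f in refine (@dfn_set _ _ X A f _ _); [dfn_rel_hyp | dfn_term]
          end ].

Ltac dfn_step :=
  cbv beta delta [shift];
  lazymatch goal with
  | |- dfn _ (fun v => _ /\ _) => apply: dfn_and
  | |- dfn _ (fun v => _ \/ _) => apply: dfn_or
  | |- dfn _ (fun v => _ <-> _) => apply: dfn_iff
  | |- dfn _ (fun v => ~ _) => apply: dfn_not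
  | |- dfn _ (fun v => exists x, @?P v x) => apply: (@dfn_ex _ _ _ P)
  | |- dfn _ (fun v => @?P v -> @?Q v) =>
      first [apply: (@dfn_imp _ _ P Q) | apply: dfn_all]
  | |- dfn _ (fun v => forall x, @?P v x) => apply: (@dfn_all _ _ _ P)
  | |- dfn _ _ => dfn_atom
  end.

Ltac definable := rewrite /dset /drel /drel3; repeat dfn_step.

(** * Linear orders *)

Record lorder (U : Type) := LOrder {
  olt : U -> U -> Prop;
  olt_irr : forall x, ~ olt x x;
  olt_trans : forall x y z, olt x y -> olt y z -> olt x z;
  olt_total : forall x y, [\/ olt x y, x = y | olt y x] }.

Notation "x ≺[ o ] y" := (olt o x y) (at level 70, format "x  ≺[ o ]  y").
Notation "x ≼[ o ] y" := (~ olt o y x) (at level 70, only parsing).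

Definition rev_order U (o : lorder U) : lorder U.
Proof.
exists (fun x y => y ≺[o] x) => [x|x y z xy yz|x y].
- exact: olt_irr.
- exact: olt_trans yz xy.
- by case: (olt_total o x y); [constructor 3|constructor 2|constructor 1].
Defined.

Section LinearOrders.
Variables (U : Type) (o : lorder U).
Implicit Types (x y z : U) (l : seq U).

Lemma ole_lt_trans x y z : x ≼[o] y -> y ≺[o] z -> x ≺[o] z.
Proof.
by move=> xy yz; case: (olt_total o x y) => [?|->|//] //; exact: olt_trans yz.
Qed.

Lemma olt_le_trans x y z : x ≺[o] y -> y ≼[o] z -> x ≺[o] z.
Proof.
by move=> xy yz; case: (olt_total o y z) => [|<-|//] //; exact: olt_trans.
Qed.

Lemma ole_trans x y z : x ≼[o] y -> y ≼[o] z -> x ≼[o] z.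
Proof. by move=> xy yz zx; apply: yz; exact: olt_le_trans zx xy. Qed.

Lemma oltW x y : x ≺[o] y -> x ≼[o] y.
Proof. by move=> xy yx; exact: olt_irr (olt_trans xy yx). Qed.

Lemma ole_antisym x y : x ≼[o] y -> y ≼[o] x -> x = y.
Proof. by case: (olt_total o x y). Qed.

Lemma oleNgt x y : ~ x ≼[o] y -> y ≺[o] x.
Proof. exact: contrapT. Qed.

End LinearOrders.

Ltac ord_add H :=
  let A := type of H in
  lazymatch goal with
  | _ : A |- _ => fail
  | _ => have := H; intro
  end.

(** Weak inequalities are negated strict ones, so four transitivity rules cover all combinations of
    strict and weak facts. *)
Ltac ord_sat :=
  repeat match goal with
  | H1 : olt ?o ?x ?y, H2 : olt ?o ?y ?z |- _ => ord_add (olt_trans H1 H2)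
  | H1 : olt ?o ?x ?y, H2 : ~ olt ?o ?z ?y |- _ => ord_add (olt_le_trans H1 H2)
  | H1 : ~ olt ?o ?y ?x, H2 : olt ?o ?y ?z |- _ => ord_add (ole_lt_trans H1 H2)
  | H1 : ~ olt ?o ?y ?x, H2 : ~ olt ?o ?z ?y |- _ => ord_add (ole_trans H1 H2)
  end.

Ltac ord :=
  intros; subst;
  lazymatch goal with
  | |- olt _ _ _ => apply: oleNgt => ?
  | |- ~ olt _ _ _ => intro
  | |- @eq ?U ?x ?y => match goal with
      | _ : @olt U ?o _ _ |- _ => apply: (@ole_antisym U o); intro
      | _ : ~ @olt U ?o _ _ |- _ => apply: (@ole_antisym U o); intro
      end
  | |- _ => exfalso
  end;
  ord_sat;
  match goal with
  | H : olt _ ?x ?x |- _ => exact: (olt_irr H)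
  | H : ~ ?A, H' : ?A |- _ => exact: (H H')
  end.

Section Extrema.
Variables (U : Type) (o : lorder U).
Implicit Types (l : seq U) (A : U -> Prop).

Lemma ex_min l A a : (forall x, A x -> List.In x l) -> A a ->
  exists m, A m /\ forall x, A x -> m ≼[o] x.
Proof.
elim: l A a => [|z l IH] A a Al Aa; first by case: (Al _ Aa).
have [[b [Ab bz]]|H] := pselect (exists b, A b /\ z <> b); last first.
  exists a; split=> // x Ax xa; apply: H.
  have [E|E] := pselect (z = a); last by exists a.
  by exists x; split=> // E'; move: xa; rewrite -E -E'; exact: olt_irr.
have [|m [[Am mz] Hm]] := IH (fun x => A x /\ z <> x) b _ (conj Ab bz).
  by move=> x [Ax xz]; case: (Al _ Ax).
have [[Az zm]|H] := pselect (A z /\ z ≺[o] m).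
  exists z; split=> // x Ax xz; have [E|E] := pselect (z = x); first ord.
  by have := Hm x (conj Ax E); ord.
exists m; split=> // x Ax xm; have [E|E] := pselect (z = x).
  by apply: H; rewrite E.
exact: Hm xm.
Qed.

End Extrema.

Lemma ex_max U (o : lorder U) (l : seq U) (A : U -> Prop) a :
  (forall x, A x -> List.In x l) -> A a ->
  exists m, A m /\ forall x, A x -> x ≼[o] m.
Proof. exact: (@ex_min _ (rev_order o)). Qed.

(** * O-minimal chains *)

(** [comin] is o-minimality by separating points: membership in [A] can change only at points of
    [l]. A chain may have end points or be a single point, which is why one-sided lemmas ask for
    some point on that side. *)
Record chain (T : Type) (D : defsys T) := Chain {
  csort :> sort D;
  cord :> lorder csort;
  cord_def : drel (olt cord);
  cdense : forall x y, x ≺[cord] y -> exists z, x ≺[cord] z /\ z ≺[cord] y;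
  comin : forall A : csort -> Prop, dset A -> exists l : seq csort,
    forall x y, x ≼[cord] y ->
      (forall z, List.In z l -> z ≺[cord] x \/ y ≺[cord] z) -> (A x <-> A y) }.

#[export] Hint Resolve cord_def drel_eq : dfn.

Section Rev.
Variables (T : Type) (D : defsys T) (K : chain D).

Definition rev_chain : chain D.
Proof.
exists K (rev_order K) => /=.
- by definable.
- by move=> x y /cdense[z [? ?]]; exists z.
- move=> A /comin[l Hl]; exists l => x y xy H; symmetry; apply: Hl => // z /H.
  by case; [right|left].
Defined.

End Rev.

Section Chains.
Variables (T : Type) (D : defsys T) (K : chain D).
Implicit Types (A B : K -> Prop) (l : seq K) (x y z : K).

Lemma free_right l a b0 : a ≺[K] b0 -> exists b, [/\ a ≺[K] b, b ≺[K] b0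
  & forall z, List.In z l -> z ≼[K] a \/ b ≺[K] z].
Proof.
move=> ab0; elim: l => [|z l [b [ab bb0 H]]].
  by have [b [? ?]] := cdense ab0; exists b; split.
have [az|za] := pselect (a ≺[K] z); last first.
  by exists b; split=> // y [<-|/H //]; left.
have [bz|zb] := pselect (b ≺[K] z).
  by exists b; split=> // y [<-|/H //]; right.
have [c [ac cz]] := cdense az; exists c; split=> //; first ord.
by move=> y [<-|/H [|]]; [right|left|right; ord].
Qed.

Lemma germ_right A a b0 : dset A -> a ≺[K] b0 ->
  exists b, [/\ a ≺[K] b, b ≺[K] b0 &
    (forall x, a ≺[K] x -> x ≺[K] b -> A x) \/
    (forall x, a ≺[K] x -> x ≺[K] b -> ~ A x)].
Proof.
move=> /comin[l Hl] /(free_right l)[b [ab bb0 H]]; exists b; split=> //.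
have Hc x y : a ≺[K] x -> x ≼[K] y -> y ≺[K] b -> (A x <-> A y).
  move=> ax xy yb; apply: Hl => // z /H[|]; first by left; ord.
  by right; ord.
have [c [ac cb]] := cdense ab.
have Hc' x : a ≺[K] x -> x ≺[K] b -> (A x <-> A c).
  move=> ax xb; have [cx|xc] := pselect (c ≺[K] x); last exact: Hc.
  by symmetry; apply: Hc => //; ord.
by have [Ac|Ac] := pselect (A c); [left|right] => x ax xb; rewrite Hc'.
Qed.

End Chains.

Section Chains2.
Variables (T : Type) (D : defsys T) (K : chain D).
Implicit Types (A B : K -> Prop) (l : seq K) (x y z : K).

Lemma free_left l b a0 : a0 ≺[K] b -> exists a, [/\ a ≺[K] b, a0 ≺[K] a
  & forall z, List.In z l -> b ≼[K] z \/ z ≺[K] a].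
Proof. exact: (@free_right _ _ (rev_chain K)). Qed.

Definition big A : Prop :=
  exists p q, p ≺[K] q /\ forall x, p ≺[K] x -> x ≺[K] q -> A x.

Lemma sub_big A B : (forall x, A x -> B x) -> big A -> big B.
Proof. by move=> AB [p [q [pq H]]]; exists p, q; split=> // x ? ?; exact/AB/H. Qed.

Lemma big_ex A : big A -> exists x, A x.
Proof. by move=> [p [q [/cdense[x [? ?]] H]]]; exists x; exact: H. Qed.

Lemma big_or A B : dset A -> big (fun x => A x \/ B x) -> big A \/ big B.
Proof.
move=> dA [p [q [pq H]]].
have [b [pb bq [HA|HA]]] := germ_right dA pq; first by left; exists p, b.
right; exists p, b; split=> // x px xb; have [|//|//] := H x px.
  ord.
by move/(HA x px xb).
Qed.

Lemma fin_nbig A l : (forall x, A x -> List.In x l) -> ~ big A.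
Proof.
move=> Al [p [q [pq H]]]; have [b [pb bq Hb]] := free_right l pq.
have [x [px xb]] := cdense pb.
have /Al/Hb[|] : A x by apply: H => //; ord.
all: ord.
Qed.

(** A point of [A] outside the separating points has a one-sided neighbourhood free of them, on
    which [A] holds. A one-point chain has no such neighbourhood and is treated apart. *)
Lemma nbig_fin A : dset A -> ~ big A -> exists l, forall x, A x -> List.In x l.
Proof.
move=> dA nA; have [l Hl] := comin dA.
have [[x0 [y0 xy0]]|H] := pselect (exists x y : K, x <> y); last first.
  have [[x Ax]|nA'] := pselect (exists x, A x); last first.
    by exists [::] => x Ax; case: nA'; exists x.
  exists [:: x] => y _; left; apply: contrapT => xy; apply: H.
  by exists x, y.
exists l => x Ax; apply: contrapT => xl; apply: nA.
have [[y xy]|H] := pselect (exists y, x ≺[K] y).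
  have [b [xb _ Hb]] := free_right l xy; exists x, b; split=> // z xz zb.
  apply/(Hl x z) => //; first ord.
  move=> w wl; case: (Hb w wl); last by right; ord.
  move=> wx; left; case: (olt_total K w x) => [//|E|//].
  by case: xl; rewrite -E.
have [y yx] : exists y, y ≺[K] x.
  case: (olt_total K x0 x) => [?|E|?]; first by exists x0.
    case: (olt_total K y0 x0) => [?|E'|?]; first by exists y0; rewrite -E.
      by case: xy0.
    by case: H; exists y0; rewrite -E.
  by case: H; exists x0.
have [b [bx _ Hb]] := free_left l yx; exists b, x; split=> // z bz zx.
apply/(Hl z x) => //; first ord.
move=> w wl; case: (Hb w wl); last by left; ord.
move=> xw; right; case: (olt_total K w x) => [//|E|//].
by case: xl; rewrite -E.
Qed.

(** Definable completeness. Let [z1] be the last among [a] and the separating points that is in [A],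
    and [z2] the first among [b] and these points that is not: [A] is constant between them, so the
    end point is one of the two. Whether [A s] holds is left open. *)
Lemma chain_cut A a b : dset A -> (forall x y, x ≺[K] y -> A y -> A x) ->
  A a -> ~ A b -> exists s, [/\ a ≼[K] s, s ≼[K] b,
    (forall x, x ≺[K] s -> A x) & (forall x, s ≺[K] x -> ~ A x)].
Proof.
move=> dA dn Aa nAb; have [l Hl] := comin dA.
have [z1 [[az1 Az1] max1]] : exists m, ((m = a \/ List.In m l) /\ A m) /\
    forall x, (x = a \/ List.In x l) /\ A x -> x ≼[K] m.
  apply: (@ex_max _ K (a :: l) _ a); last by split=> //; left.
  by move=> x [[->|]]; [left|right].
have [z2 [[bz2 nAz2] min2]] : exists m, ((m = b \/ List.In m l) /\ ~ A m) /\
    forall x, (x = b \/ List.In x l) /\ ~ A x -> m ≼[K] x.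
  apply: (@ex_min _ K (b :: l) _ b); last by split=> //; left.
  by move=> x [[->|]]; [left|right].
have az : a ≼[K] z1 by apply: max1; split=> //; left.
have zb : z2 ≼[K] b by apply: min2; split=> //; left.
have z12 : z1 ≺[K] z2.
  case: (olt_total K z1 z2) => [//|E|/dn H]; first by case: nAz2; rewrite -E.
  by case: nAz2; exact: H.
have Hc x y : z1 ≺[K] x -> x ≼[K] y -> y ≺[K] z2 -> (A x <-> A y).
  move=> z1x xy yz2; apply: Hl => // z zl; have [Az|nAz] := pselect (A z).
    by left; have := max1 z (conj (or_intror zl) Az); ord.
  by right; have := min2 z (conj (or_intror zl) nAz); ord.
have [[c [[z1c cz2] Ac]]|H] :=
    pselect (exists c, (z1 ≺[K] c /\ c ≺[K] z2) /\ A c).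
  exists z2; split=> //; first ord; last by move=> x z2x Ax; exact: nAz2 (dn _ _ z2x Ax).
  move=> x xz2; have [xc|cx] := pselect (c ≺[K] x); last first.
    by case: (olt_total K x c) => [/dn|->|//]; exact.
  by apply/(Hc c x) => //; ord.
exists z1; split=> //; first ord; first by move=> x /dn; exact.
move=> x z1x Ax; apply: H; have [xz2|z2x] := pselect (x ≺[K] z2).
  by exists x.
case: nAz2; case: (olt_total K z2 x) => [/dn|->|//]; exact.
Qed.

(* Local constancy at [t]; a condition at a side where [K] stops is void. *)
Definition loc_const A t : Prop :=
  (forall b, t ≺[K] b -> exists b', t ≺[K] b' /\
     forall y, t ≺[K] y -> y ≺[K] b' -> (A y <-> A t)) /\
  (forall a, a ≺[K] t -> exists a', a' ≺[K] t /\
     forall y, a' ≺[K] y -> y ≺[K] t -> (A y <-> A t)).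

Lemma fin_boundary A : dset A ->
  exists l, forall t, ~ loc_const A t -> List.In t l.
Proof.
move=> /comin[l Hl]; exists l => t; apply: contra_notP => tl; split=> b tb.
  have [b' [tb' _ H]] := free_right l tb; exists b'; split=> // y ty yb.
  symmetry; apply: Hl; first ord.
  move=> z zl; case: (H z zl) => [tz|bz]; last by right; ord.
  by left; case: (olt_total K z t) => // E; case: tl; rewrite -E.
have [b' [tb' _ H]] := free_left l tb; exists b'; split=> // y ty yb.
apply: Hl; first ord.
move=> z zl; case: (H z zl) => [tz|bz]; last by left; ord.
by right; case: (olt_total K z t) => // E; case: tl; rewrite -E.
Qed.

(** Definable connectedness: the points up to which [A] keeps its value at [x] would form a cut, and
    [A] could not be locally constant at its end point. *)
Lemma loc_const_const A x y : dset A -> x ≼[K] y ->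
  (forall t, x ≼[K] t -> t ≼[K] y -> loc_const A t) -> (A x <-> A y).
Proof.
move=> dA xy Hloc; apply: contrapT => nAxy.
pose A' z := forall u, x ≼[K] u -> u ≼[K] z -> (A u <-> A x).
have [] := @chain_cut A' x y.
- rewrite /A'; definable.
- by move=> u v uv Av w xw wu; apply: Av => //; ord.
- by move=> u xu ux; have -> : u = x by ord.
- by move=> /(_ y xy (@olt_irr _ K y)) ?; apply: nAxy; symmetry.
move=> s [xs sy dn up]; have [locR locL] := Hloc s xs sy.
have As u : x ≼[K] u -> u ≺[K] s -> (A u <-> A x).
  by move=> xu us; apply: (dn u us) => //; exact: olt_irr.
have [A's|nA's] := pselect (A' s).
  have sy' : s ≺[K] y.
    case: (olt_total K s y) => [//|E|//]; case: nAxy; symmetry.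
    by apply: A's => //; rewrite -E; exact: olt_irr.
  have [b [sb H]] := locR _ sy'; have [u [su ub]] := cdense sb.
  apply: (up u su) => w xw wu; have [sw|ws] := pselect (s ≺[K] w).
    by rewrite (H w) //; [apply: A's => //; exact: olt_irr|ord].
  exact: A's.
have xs' : x ≺[K] s.
  case: (olt_total K x s) => [//|E|//]; case: nA's => w xw ws.
  by have -> : w = x by ord.
have [a [ax H]] := locL _ xs'; apply: nA's => w xw ws.
case: (olt_total K w s) => [ws'|->|//]; first exact: As.
have [u [us xu au]] : exists u, [/\ u ≺[K] s, x ≺[K] u & a ≺[K] u].
  have [ax'|xa] := pselect (x ≺[K] a).
    by have [u [? ?]] := cdense ax; exists u; split=> //; ord.
  by have [u [? ?]] := cdense xs'; exists u; split=> //; ord.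
by rewrite -(H u) //; apply: As => //; ord.
Qed.

End Chains2.

(** * Generic points of chains *)

Lemma fin_image U V (r : U -> V -> Prop) (l : seq U) :
  (forall x y z, r x y -> r x z -> y = z) ->
  exists l', forall x y, List.In x l -> r x y -> List.In y l'.
Proof.
move=> fr; elim: l => [|x l [l' IH]]; first by exists [::] => ? ? [].
have [[y xy]|H] := pselect (exists y, r x y).
  exists (y :: l') => x' y' [<-|xl] xy'; first by left; exact: fr xy xy'.
  by right; exact: IH xy'.
exists l' => x' y' [<-|xl] xy; last exact: IH xy.
by case: H; exists y'.
Qed.

Section Big.
Variables (T : Type) (D : defsys T).

Lemma big_rev (K : chain D) (A : K -> Prop) :
  @big _ _ (rev_chain K) A <-> @big _ _ K A.
Proof.
by split=> -[p [q [pq H]]]; exists q, p; (split; first exact: pq) => x ? ?;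
  exact: H.
Qed.

Lemma big_list (K : chain D) (U : Type) (l : seq U) (A : U -> K -> Prop) :
  (forall u, dset (A u)) -> big (fun x => exists u, List.In u l /\ A u x) ->
  exists u, List.In u l /\ big (A u).
Proof.
move=> dA; elim: l => [/big_ex[x [u [[]]]]|u l IH H].
have [H1|[w [? ?]]] : big (A u) \/ exists w, List.In w l /\ big (A w).
- have [||//|/IH] := @big_or _ _ K (A u) (fun x => exists w, List.In w l /\ A w x).
  + exact: dA.
  + apply: sub_big H => x [w [[->|wl] Aw]]; [by left|right; by exists w].
  + by left.
  + by right.
- by exists u; split=> //; left.
- by exists w; split=> //; right.
Qed.

(* The [x] having some [u] with [N x u] but [~ N x' u] for all [x'] in
   ]c, x[ accumulate at [c], hence fill an interval ]c, b[. *)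
Lemma no_records (K : chain D) (J : sort D) (N : K -> J -> Prop) c c' :
  drel N -> c ≺[K] c' -> (forall u, ~ big (fun x => N x u)) ->
  (forall x, c ≺[K] x -> x ≺[K] c' -> exists u, N x u) ->
  (forall x u, c ≺[K] x -> x ≺[K] c' -> N x u -> exists b, x ≺[K] b /\
     forall y u', x ≺[K] y -> y ≺[K] b -> N y u' -> ~ N x u' -> N y u) ->
  False.
Proof.
move=> dN cc' fN exN nestN.
pose Rec x := exists u, N x u /\ forall x', c ≺[K] x' -> x' ≺[K] x -> ~ N x' u.
have dRec : dset Rec by rewrite /Rec; definable.
have [b [cb bc' [HR|HR]]] := germ_right dRec cc'.
  (* Records fill []c, b[]: each [y] just right of [x] brings a [u'] new at [y], and nesting gives
     [N y u], against [fN u]. *)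
  have [x [cx xb]] := cdense cb; have [u Nu] : exists u, N x u by apply: exN; ord.
  have [||b1 [xb1 Hb1]] := nestN _ _ _ _ Nu; [ord|ord|].
  have [b2 [xb2 b2b1 b2b]] :
      exists b2, [/\ x ≺[K] b2, b2 ≼[K] b1 & b2 ≼[K] b].
    have [bb1|b1b] := pselect (b ≺[K] b1).
      by exists b; split=> //; ord.
    by exists b1; split=> //; ord.
  apply: (fN u); exists x, b2; split=> // y xy yb2.
  have [u' [Nu' Hu']] : Rec y by apply: HR; ord.
  by apply: Hb1 Nu' _ => //; [ord|exact: Hu'].
(* No records in []c, b[]: but the least point above [c] related to [u] is one. *)
have [x [cx xb]] := cdense cb; have [u Nu] : exists u, N x u by apply: exN; ord.
have [|l Hl] := @nbig_fin _ _ K (fun x => N x u) _ (fN u); first by definable.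
have [|m [[Nm cm] Hm]] := @ex_min _ K l (fun x => N x u /\ c ≺[K] x) x _ (conj Nu cx).
  by move=> y [/Hl].
have xm := Hm x (conj Nu cx).
apply: (HR m) => //; first ord.
by exists u; split=> // x' cx' x'm Nx'; exact: Hm (conj Nx' cx') x'm.
Qed.

(** Suppose every S^t is finite, and let f(x) be the least s >= t0 such that S_x fills some ]s, b[;
    the bound [t0] makes this infimum exist. Either f is constant on an interval of [I], or its
    finite fibres give a partial inverse [h] on an interval of [J]. In both cases the intervals ]s,
    u] inside the sections of [S] are nested as [no_records] forbids. *)
Lemma half_fubini (I J : chain D) (S : I -> J -> Prop) (t0 : J) (p q : I) :
  drel S -> p ≺[I] q -> (forall x, p ≺[I] x -> x ≺[I] q ->
  big (fun t => t0 ≺[J] t /\ S x t)) -> exists t, big (fun x => S x t).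
Proof.
move=> dS pq bigS; apply: contrapT => /forallNP nS.
pose P x s := t0 ≼[J] s /\
  exists b, s ≺[J] b /\ forall t, s ≺[J] t -> t ≺[J] b -> S x t.
pose f x s := P x s /\ forall s', P x s' -> s ≼[J] s'.
have dP : drel P by rewrite /P; definable.
have df : drel f by rewrite /f; definable.
have exf x : p ≺[I] x -> x ≺[I] q -> exists s, f x s.
  move=> px xq; have [a [b [ab Hab]]] := bigS x px xq.
  have [s1 [as1 s1b]] := cdense ab.
  have Ps1 : P x s1.
    split; first by have [? _] := Hab s1 as1 s1b; ord.
    by exists b; split=> // t st tb; apply: (Hab t _ tb).2; ord.
  have [||||s [t0s sb dn up]] :=
      @chain_cut _ _ J (fun z => forall s', P x s' -> z ≼[J] s') t0 b.
  - by definable.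
  - by move=> u v uv Hv s' /Hv; ord.
  - by move=> s' [].
  - by move=> /(_ _ Ps1).
  have As s' : P x s' -> s ≼[J] s'.
    by move=> Ps' s's; have [u [s'u us]] := cdense s's; exact: (dn u us s').
  (* The infimum is attained: otherwise [S x] fails on some []s, b'[], and no element of [P x] can
     lie close to [s]. *)
  exists s; split=> //; apply: contrapT => nPs.
  have ss1 : s ≺[J] s1.
    by case: (olt_total J s s1) => [//|E|/(As _ Ps1)//]; case: nPs; rewrite E.
  have [b' [sb' _ [HS|HS]]] := @germ_right _ _ J (S x) s s1 ltac:(definable) ss1.
    by apply: nPs; split=> //; exists b'.
  have [u [su ub']] := cdense sb'; apply: (up u su) => s' Ps' s'u.
  have ss' : s ≺[J] s'.
    by case: (olt_total J s s') => [//|E|/(As _ Ps')//]; case: nPs; rewrite E.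
  have [_ [b'' [s'b'' Hb'']]] := Ps'.
  have [w [s'w wb'']] := cdense s'b''.
  have [ub''|b''u] := pselect (u ≺[J] b'').
    by apply: (HS u) => //; apply: Hb''.
  by apply: (HS w); [ord|ord|apply: Hb''].
have [[s [p1 [q1 [pq1 Hs]]]]|nf] := pselect (exists s, big (fun x => f x s)).
  apply: (@no_records I J (fun x u => f x s /\ (s ≺[J] u /\
    forall t, s ≺[J] t -> t ≼[J] u -> S x t)) p1 q1) => //.
  - by definable.
  - move=> u H; apply: (nS u); apply: sub_big H => x [_ [su]].
    by apply=> //; exact: olt_irr.
  - move=> x px xq; have fx := Hs x px xq; have [[_ [b [sb Hb]]] _] := fx.
    have [u [su ub]] := cdense sb; exists u; split=> //; split=> // t st tu.
    by apply: Hb => //; ord.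
  - move=> x u px xq [fx [su Hu]]; exists q1; split=> // y u' xy yq Ny nNx.
    have [fy [su' Hu']] := Ny.
    have uu' : u ≺[J] u'.
      apply: contrapT => u'u; apply: nNx; split=> //; split=> // t st tu'.
      by apply: Hu => //; ord.
    split; first by apply: Hs => //; ord.
    by split=> // t st tu; apply: Hu' => //; ord.
have [k1 [k2 [k12 Hk]]] : big (fun s => exists x, [/\ p ≺[I] x, x ≺[I] q & f x s]).
  apply: contrapT => nb.
  have [||l Hl] := @nbig_fin _ _ J (fun s => exists x, (p ≺[I] x /\ x ≺[I] q) /\ f x s).
  - by definable.
  - by move=> H; apply: nb; apply: sub_big H => s [x [[? ?] ?]]; exists x.
  have [||s [_ bs]] := @big_list I J l (fun s x => f x s).
  - by move=> s; definable.
  - exists p, q; split=> // x px xq; have [s fs] := exf x px xq.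
    by exists s; split=> //; apply: Hl; exists x.
  by apply: nf; exists s.
pose h s x := ((p ≺[I] x /\ x ≺[I] q) /\ f x s) /\
  forall x', (p ≺[I] x' /\ x' ≺[I] q) /\ f x' s -> x ≼[I] x'.
have fI x s s' : f x s -> f x s' -> s = s'.
  by move=> [Ps ms] [Ps' ms']; have := ms _ Ps'; have := ms' _ Ps; ord.
have hI s x x' : h s x -> h s x' -> x = x'.
  by move=> [H m] [H' m']; have := m _ H'; have := m' _ H; ord.
have dh : drel h by rewrite /h; definable.
have exh s : k1 ≺[J] s -> s ≺[J] k2 -> exists x, h s x.
  move=> ks sk; have [x [px xq fx]] := Hk s ks sk.
  have [||l Hl] := @nbig_fin _ _ I (fun x => f x s); first by definable.
    by move=> H; apply: nf; exists s.
  have [|m [Hm mm]] := @ex_min _ I l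
    (fun x => (p ≺[I] x /\ x ≺[I] q) /\ f x s) x _ (conj (conj px xq) fx).
    by move=> y [_ /Hl].
  by exists m.
(* Now [s] is the running variable. For fixed [u] there are finitely many [x] with [S x u], hence
   finitely many values [s] of [f] at them. *)
apply: (@no_records J J (fun s u => exists x, h s x /\ (s ≺[J] u /\
    forall t, s ≺[J] t -> t ≼[J] u -> S x t)) k1 k2) => //.
- by definable.
- move=> u; have [|l Hl] := @nbig_fin _ _ I (fun x => S x u) _ (nS u).
    by definable.
  have [l' Hl'] := @fin_image _ _ f l fI.
  apply: (@fin_nbig _ _ J _ l') => s [x [[[_ fx] _] [su Hu]]].
  by apply: Hl' fx; apply/Hl/Hu => //; exact: olt_irr.
- move=> s ks sk; have [x hx] := exh s ks sk.
  have [[_ [[_ [b [sb Hb]]] _]] _] := hx.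
  have [u [su ub]] := cdense sb; exists u, x; split=> //; split=> // t st tu.
  by apply: Hb => //; ord.
- move=> s u ks sk [x [hx [su Hu]]]; exists u; split=> // y u' sy yu.
  move=> [x' [hx' [yu' Hu']]] nNs.
  have uu' : u ≺[J] u'.
    apply: contrapT => u'u; apply: nNs; exists x; split=> //; split; first ord.
    by move=> t st tu'; apply: Hu => //; ord.
  by exists x'; split=> //; split=> // t yt tu; apply: Hu' => //; ord.
Qed.

(** One of the halves above and below a fixed [t0] is big for an interval of [x]; the lower half is
    the upper half of the reversed chain. *)
Theorem fubini (I J : chain D) (S : I -> J -> Prop) : drel S ->
  big (fun x => big (fun t => S x t)) -> exists t, big (fun x => S x t).
Proof.
move=> dS [p [q [pq bigS]]]; have [x0 [px0 x0q]] := cdense pq.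
have [a [b [ab _]]] := bigS x0 px0 x0q; have [t0 _] := cdense ab.
pose up x := big (fun t => t0 ≺[J] t /\ S x t).
pose dn x := big (fun t => t ≺[J] t0 /\ S x t).
have [||[p' [q' [pq' H]]]|[p' [q' [pq' H]]]] := @big_or _ _ I up dn.
- by rewrite /up /big; definable.
- exists p, q; split=> // x px xq.
  have [||?|H] := @big_or _ _ J (fun t => t0 ≺[J] t /\ S x t)
    (fun t => t = t0 \/ t ≺[J] t0 /\ S x t); first by definable.
  + apply: sub_big (bigS x px xq) => t St.
    by case: (olt_total J t t0); [right; right|right; left|left].
  + by left.
  have [|H'|?] := @big_or _ _ J (fun t => t = t0)
    (fun t => t ≺[J] t0 /\ S x t) _ H; first by definable.
  + by exfalso; apply: (@fin_nbig _ _ J _ [:: t0] _ H') => t ->; left.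
  + by right.
- exact: half_fubini dS pq' H.
- apply: (@half_fubini I (rev_chain J) S t0 p' q' dS pq') => x px xq.
  by apply/big_rev; exact: H.
Qed.

(* Monotonicity: for [R x y := f x <= f y] this is the monotonicity theorem. *)
Lemma homogeneous (K : chain D) (R : K -> K -> Prop) a b :
  drel R -> a ≺[K] b -> exists p q, [/\ p ≺[K] q, a ≼[K] p, q ≼[K] b &
    (forall x y, p ≺[K] x -> x ≺[K] y -> y ≺[K] q -> R x y) \/
    (forall x y, p ≺[K] x -> x ≺[K] y -> y ≺[K] q -> ~ R x y)].
Proof.
move=> dR ab.
have key (Q : K -> K -> Prop) : drel Q ->
    big (fun x => (a ≺[K] x /\ x ≺[K] b) /\ exists c, x ≺[K] c /\
      forall y, x ≺[K] y -> y ≺[K] c -> Q x y) ->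
    exists p q, [/\ p ≺[K] q, a ≼[K] p, q ≼[K] b &
      forall x y, p ≺[K] x -> x ≺[K] y -> y ≺[K] q -> Q x y].
  move=> dQ [p [q [pq H]]].
  (* [Q x] holds on some []x, c[] with [c] depending on [x]; Fubini provides one bound [u] for an
     interval of [x]. *)
  have [||u [p' [q' [pq' H']]]] := @fubini K K (fun x u =>
    (a ≺[K] x /\ x ≺[K] b) /\ (x ≺[K] u /\
      forall y, x ≺[K] y -> y ≺[K] u -> Q x y)); first by definable.
    exists p, q; split=> // x px xq; have [abx [c [xc Hc]]] := H x px xq.
    exists x, c; split=> // u xu uc; split=> //; split=> // y xy yu.
    by apply: Hc => //; ord.
  exists p', q'; split=> //.
  - move=> p'a; have [x [p'x xq]] := cdense pq'.
    have [z [? ?]] : exists z, p' ≺[K] z /\ z ≺[K] a by exact: cdense.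
    have [zq|qz] := pselect (z ≺[K] q').
      by have [[[? ?] _] _] := conj (H' z ltac:(ord) zq) I; ord.
    by have [[? ?] _] := H' x p'x xq; ord.
  - move=> bq; have [x [p'x xq]] := cdense pq'.
    have [z [? ?]] : exists z, b ≺[K] z /\ z ≺[K] q' by exact: cdense.
    have [zp|pz] := pselect (p' ≺[K] z).
      by have [[? ?] _] := H' z zp ltac:(ord); ord.
    by have [[? ?] _] := H' x p'x xq; ord.
  - move=> x y px xy yq; have [|_ [_ Hx]] := H' x px; first ord.
    apply: Hx => //.
    have [z [yz zq]] := cdense yq.
    by have [_ [zu _]] := H' z ltac:(ord) zq; ord.
have [||Rb|Rb] := @big_or _ _ K (fun x => (a ≺[K] x /\ x ≺[K] b) /\ exists c, x ≺[K] c /\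
      forall y, x ≺[K] y -> y ≺[K] c -> R x y)
  (fun x => (a ≺[K] x /\ x ≺[K] b) /\ exists c, x ≺[K] c /\
      forall y, x ≺[K] y -> y ≺[K] c -> ~ R x y).
- by definable.
- exists a, b; split=> // x ax xb.
  have [|c [xc _ [H|H]]] := @germ_right _ _ K (R x) x b _ xb; first by definable.
    by left; split=> //; exists c.
  by right; split=> //; exists c.
- by have [p [q [? ? ? ?]]] := key R dR Rb; exists p, q; split=> //; left.
- have [|p [q [? ? ? ?]]] := key (fun x y => ~ R x y) _ Rb; first by definable.
  by exists p, q; split=> //; right.
Qed.

End Big.

(** * Ordered groups and dimension *)

Record ogroup (T : Type) (D : defsys T) := OGroup {
  gsort :> sort D;
  gord :> lorder gsort;
  gmul : gsort -> gsort -> gsort;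
  gone : gsort;
  ginv : gsort -> gsort;
  gord_def : drel (olt gord);
  gmul_def : drel3 (fun z x y => z = gmul x y);
  ginv_def : drel (fun y x => y = ginv x);
  gmulA : forall x y z, gmul x (gmul y z) = gmul (gmul x y) z;
  gmul1g : forall x, gmul gone x = x;
  gmulg1 : forall x, gmul x gone = x;
  gmulVg : forall x, gmul (ginv x) x = gone;
  gmulgV : forall x, gmul x (ginv x) = gone;
  gltl : forall x y z, x ≺[gord] y -> gmul z x ≺[gord] gmul z y;
  gltr : forall x y z, x ≺[gord] y -> gmul x z ≺[gord] gmul y z }.

#[export] Hint Resolve gord_def gmul_def ginv_def : dfn.
Arguments gone {T D o}.

Notation "x ⋅ y" := (gmul x y) (at level 40, left associativity).
Notation "x ^^-1" := (ginv x) (at level 3, left associativity, format "x ^^-1").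

Section GroupTheory.
Variables (T : Type) (D : defsys T) (G : ogroup D).
Implicit Types (x y z g h : G).

Lemma gmulKg x y : x^^-1 ⋅ (x ⋅ y) = y.
Proof. by rewrite gmulA gmulVg gmul1g. Qed.

Lemma gmulKVg x y : x ⋅ (x^^-1 ⋅ y) = y.
Proof. by rewrite gmulA gmulgV gmul1g. Qed.

Lemma gmulgK x y : x ⋅ y ⋅ y^^-1 = x.
Proof. by rewrite -gmulA gmulgV gmulg1. Qed.

Lemma gmulgKV x y : x ⋅ y^^-1 ⋅ y = x.
Proof. by rewrite -gmulA gmulVg gmulg1. Qed.

Lemma gmul_inj x y z : x ⋅ y = x ⋅ z -> y = z.
Proof. by move=> E; rewrite -(gmulKg x y) E gmulKg. Qed.

Lemma ginv_uniq x y : x ⋅ y = gone -> y = x^^-1.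
Proof. by move=> E; apply: (@gmul_inj x); rewrite E gmulgV. Qed.

Lemma ginvK x : x^^-1^^-1 = x.
Proof. by rewrite -(@ginv_uniq x^^-1 x) ?gmulVg. Qed.

Lemma ginvM x y : (x ⋅ y)^^-1 = y^^-1 ⋅ x^^-1.
Proof.
by symmetry; apply: ginv_uniq; rewrite -gmulA (gmulA y) gmulgV gmul1g gmulgV.
Qed.

Lemma gltl_iff x y z : (z ⋅ x ≺[G] z ⋅ y) <-> (x ≺[G] y).
Proof.
by split=> [/(@gltl _ _ _ _ _ z^^-1)|]; [rewrite !gmulKg|exact: gltl].
Qed.

Lemma gltr_iff x y z : (x ⋅ z ≺[G] y ⋅ z) <-> (x ≺[G] y).
Proof.
by split=> [/(@gltr _ _ _ _ _ z^^-1)|]; [rewrite !gmulgK|exact: gltr].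
Qed.

Lemma gltV x y : (x^^-1 ≺[G] y^^-1) <-> (y ≺[G] x).
Proof.
rewrite -(gltl_iff _ _ x) gmulgV -(gltr_iff _ _ y) gmul1g gmulgKV.
by [].
Qed.

(** With [R] equality this is finiteness; with [R] the relation of lying in the same left coset, it
    says that [A] meets finitely many cosets. *)
Definition fin_mod (R : G -> G -> Prop) (A : G -> Prop) : Prop :=
  exists l, forall x, A x -> exists y, List.In y l /\ R y x.

Lemma fin_mod_list U (R : G -> G -> Prop) (l : seq U) (A : U -> G -> Prop) :
  (forall u, List.In u l -> fin_mod R (A u)) ->
  fin_mod R (fun x => exists u, List.In u l /\ A u x).
Proof.
elim: l => [|u l IH] H; first by exists [::] => x [? []].
have [|l1 H1] := IH; first by move=> w wl; apply: H; right.
have [|l2 H2] := H u; first by left.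
exists (l1 ++ l2)%list => x [w [[<-|wl] Aw]].
  by have [y [? ?]] := H2 x Aw; exists y; split=> //; apply: List.in_or_app; right.
have [|y [? ?]] := H1 x; first by exists w.
by exists y; split=> //; apply: List.in_or_app; left.
Qed.

(* A decomposition [E 0, ..., E n] extended by equality as [E n.+1]; only the
   fibration of its classes over chains is kept. *)
Record tower n (E : nat -> G -> G -> Prop) : Prop := Tower {
  tower_def : forall i, i <= n -> drel (E i);
  tower_fin : exists l, forall x, exists w, List.In w l /\ E 0 w x;
  tower_eq : forall x y, E n.+1 x y -> x = y;
  tower_chain : forall i w, i <= n -> exists (J : chain D) (p : G -> J),
    drel (fun t x => t = p x) /\
    forall x y, E i w x -> E i w y -> p x = p y -> E i.+1 x y }.

(** Descend through classes on which [B] is not finite modulo [R]. The descent cannot reach the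
    singletons of level [n.+1], so at some level every fibre over the chain is finite modulo [R]. *)
Lemma tower_level n E (R : G -> G -> Prop) (B : G -> Prop) :
  tower n E -> (forall x, R x x) -> dset B -> ~ fin_mod R B ->
  exists (J : chain D) (p : G -> J) (X : G -> Prop),
    [/\ dset X, drel (fun t x => t = p x), forall x, X x -> B x,
      ~ fin_mod R X & forall t, fin_mod R (fun x => X x /\ p x = t)].
Proof.
move=> tw refR dB nB.
have key m : forall i w, i + m = n.+1 -> ~ fin_mod R (fun x => B x /\ E i w x) ->
    exists (J : chain D) (p : G -> J) (X : G -> Prop),
      [/\ dset X, drel (fun t x => t = p x), forall x, X x -> B x,
      ~ fin_mod R X & forall t, fin_mod R (fun x => X x /\ p x = t)].
  elim: m => [|m IH] i w im nE.
    case: nE; exists [:: w] => x [_]; rewrite addn0 in im; rewrite im.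
    by move/(tower_eq tw) => <-; exists w; split=> //; left.
  have i_n : i <= n by rewrite -ltnS -im addnS ltnS leq_addr.
  have [J [p [dp Hp]]] := tower_chain tw w i_n.
  have dE := tower_def tw i_n.
  have [H|/existsNP[t Ht]] :=
      pselect (forall t, fin_mod R (fun x => (B x /\ E i w x) /\ p x = t)).
    exists J, p, (fun x => B x /\ E i w x); split=> //; first by definable.
    by move=> x [].
  have [[y [[By Ey] pyt]]|H] := pselect (exists y, (B y /\ E i w y) /\ p y = t).
    apply: (IH i.+1 y); first by rewrite addSnnS.
    move=> [l Hl]; apply: Ht; exists l => x [[Bx Ex] pxt]; apply: Hl; split=> //.
    by apply: Hp => //; rewrite pxt.
  by case: Ht; exists [::] => x Hx; case: H; exists x.
have [l Hl] := tower_fin tw.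
have [H|] := pselect (forall w, List.In w l -> fin_mod R (fun x => B x /\ E 0 w x)).
  have [l' Hl'] := fin_mod_list H; case: nB; exists l' => x Bx; apply: Hl'.
  by have [w [? ?]] := Hl x; exists w.
move=> /existsNP[w /not_implyP[_ nw]]; exact: (key n.+1 0 w).
Qed.

(* Applied to the cosets of a subgroup, whose traces on a chain have no
   canonical point but finitely many boundary points; hence a relation. *)
Record chart := Chart {
  chart_chain : chain D;
  chart_rel :> G -> chart_chain -> Prop;
  chart_def : drel chart_rel;
  chart_fin : forall h, exists l, forall t, chart_rel h t -> List.In t l }.

(** * Dimension relative to a list of charts *)

Implicit Types (c : chart) (l : seq chart) (X Y : G -> Prop).

Definition cstab c g : Prop := forall h t, c h t -> c (h ⋅ g) t.

(* Translated by [g^-1], the set [X] has dimension at least [size l], as seen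
   by the charts [l]. *)
Fixpoint large l X g : Prop :=
  if l is c :: l' then
    big (fun t : chart_chain c => exists h, c h t /\ large l' X (g ⋅ h))
  else X g.

(** Larger subgroups come first: a later chart lives on a smaller subgroup, whose right translations
    preserve the cosets seen by an earlier chart. *)
Fixpoint compat l : Prop :=
  if l is c :: l' then
    (forall c', List.In c' l' -> forall h t, c' h t -> cstab c h) /\ compat l'
  else True.

Lemma large_def (J : sort D) (X : J -> G -> Prop) l : drel X ->
  drel (fun t g => large l (X t) g).
Proof.
move=> dX; elim: l => [|c l IH] //=.
have dc := chart_def c.
pose R t g := large l (X t) g.
have dR : drel R by exact: IH.
suff : drel (fun t g => big (fun s => exists h, c h s /\ R t (g ⋅ h))) by [].
rewrite /big; definable.
Qed.

Lemma large_dset X l : dset X -> dset (large l X).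
Proof.
move=> dX; have dR := @large_def G (fun=> X) l ltac:(definable).
pose R (t : G) g := large l X g.
have {}dR : drel R by [].
suff : dset (fun g => R gone g) by [].
definable.
Qed.

Lemma sub_large X Y l g : (forall x, X x -> Y x) -> large l X g -> large l Y g.
Proof.
move=> XY; elim: l g => [|c l IH] g /=; first exact: XY.
by apply: sub_big => t [h [? ?]]; exists h; split=> //; exact: IH.
Qed.

Lemma large_ex X l g : large l X g -> exists x, X x.
Proof.
elim: l g => [|c l IH] g /=; first by exists g.
by move=> /big_ex[t [h [_ /IH]]].
Qed.

Lemma large_or X Y l g : dset X -> large l (fun x => X x \/ Y x) g ->
  large l X g \/ large l Y g.
Proof.
move=> dX; elim: l g => [|c l IH] g //= H.
have dc := chart_def c; have dl := large_dset l dX.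
apply: big_or; first by definable.
apply: sub_big H => t [h [ht /IH[?|?]]]; [left|right]; by exists h.
Qed.

Lemma large_list U (L : seq U) (X : U -> G -> Prop) l g :
  (forall u, dset (X u)) -> large l (fun x => exists u, List.In u L /\ X u x) g ->
  exists u, List.In u L /\ large l (X u) g.
Proof.
move=> dX; elim: L => [|u L IH] H; first by have [x [u [[]]]] := large_ex H.
have [H1|[w [? ?]]] : large l (X u) g \/ exists w, List.In w L /\ large l (X w) g.
- have [||?|/IH ?] := @large_or (X u) (fun x => exists u, List.In u L /\ X u x) l g.
  + exact: dX.
  + apply: sub_large H => x [w [[->|wL] Xw]]; [by left|by right; exists w].
  + by left.
  + by right.
- by exists u; split=> //; left.
- by exists w; split=> //; right.
Qed.

Lemma cstab1 c : cstab c gone.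
Proof. by move=> h t; rewrite gmulg1. Qed.

Lemma cstabM c g h : cstab c g -> cstab c h -> cstab c (g ⋅ h).
Proof. by move=> Hg Hh x t /Hg/Hh; rewrite gmulA. Qed.

(** Records that [h] is a product of elements from the domains of [l], by the effect this has on
    stabilizers of charts. *)
Definition stab_by l h : Prop :=
  forall c0, (forall c, List.In c l -> forall h' t, c h' t -> cstab c0 h') ->
  cstab c0 h.

Lemma large_point X l g : large l X g -> exists h, stab_by l h /\ X (g ⋅ h).
Proof.
elim: l g => [|c l IH] g /=.
  by move=> Xg; exists gone; rewrite gmulg1; split=> // c0 _; exact: cstab1.
move=> /big_ex[t [h [ht /IH[h' [sh' Xh']]]]].
exists (h ⋅ h'); rewrite gmulA; split=> // c0 H; apply: cstabM.
  by apply: H ht; left.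
by apply: sh' => c' c'l; apply: H; right.
Qed.

Fixpoint remove_at (j : nat) l : seq chart :=
  match l, j with
  | [::], _ => [::]
  | _ :: l', 0 => l'
  | c :: l', j'.+1 => c :: remove_at j' l'
  end.

Lemma In_remove_at j l c : List.In c (remove_at j l) -> List.In c l.
Proof.
elim: l j => [|c' l IH] [|j] //=; first by right.
by case=> [|/IH]; [left|right].
Qed.

Lemma compat_remove_at j l : compat l -> compat (remove_at j l).
Proof.
elim: l j => [|c l IH] [|j] //= [H ?] //; split; last exact: IH.
by move=> c' /In_remove_at; exact: H.
Qed.

Lemma size_remove_at j l : j < size l -> size l = (size (remove_at j l)).+1.
Proof. by elim: l j => [|c l IH] [|j] //= /IH ->. Qed.

Definition within (J : sort D) (L : seq J) t : Prop := List.In t L.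

Lemma within_def (J : sort D) (L : seq J) : dset (within L).
Proof.
elim: L => [|u L dL]; first exact: dfn_cst.
suff : dset (fun t => u = t \/ within L t) by [].
definable.
Qed.

Lemma In_iota m n j : List.In j (iota m n) <-> m <= j < m + n.
Proof.
elim: n m => [|n IH] m /=.
  by rewrite addn0; split=> // /andP[mj jm]; move: (leq_ltn_trans mj jm); rewrite ltnn.
rewrite IH addSnnS; split=> [[<-|/andP[/ltnW -> ->]]|/andP[]] //.
  by rewrite leqnn -addSnnS leq_addr.
by rewrite leq_eqVlt => /predU1P[->|mj ->]; [left|right; rewrite mj].
Qed.

(* The dimension inequality: the fibres of a map to a chain cannot all be
   more than one dimension smaller. *)
Lemma large_fiber (J : chain D) (p : G -> J) X l g :
  drel (fun t x => t = p x) -> dset X -> compat l -> l <> [::] -> large l X g ->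
  exists j t h, [/\ j < size l, stab_by l h
    & large (remove_at j l) (fun x => X x /\ p x = t) (g ⋅ h)].
Proof.
move=> dp; elim: l X g => [//|c l IH] X g dX [compc cl] _ Hlarge.
have [El|El] := pselect (l = [::]).
  rewrite El /= in Hlarge *; have [t [h [ht Xh]]] := big_ex Hlarge.
  exists 0, (p (g ⋅ h)), h; split=> // c0 H; by apply: H ht; left.
(* If some fibre is still large for all of [l], the outermost chart is the one to drop. *)
have [[t1 [h [t [ht Ht]]]]|noc] := pselect (exists t1 h t, c h t1 /\
    large l (fun x => X x /\ p x = t) (g ⋅ h)).
  exists 0, t, h; split=> // c0 H; by apply: H ht; left.
pose Th j t1 t := exists h, c h t1 /\
  large (remove_at j l) (fun x => X x /\ p x = t) (g ⋅ h).
have dTh j : drel (Th j).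
  have dc := chart_def c.
  pose R t g := large (remove_at j l) (fun x => X x /\ p x = t) g.
  have dR : drel R by apply: large_def; definable.
  suff : drel (fun t1 t => exists h, c h t1 /\ R t (g ⋅ h)) by [].
  definable.
(* For a big set of [t1], one index [j] has a big set of [t]. Were the [t] occurring at [t1] within
   a finite list [L], then the part of [X] over [L] would yield a fibre excluded by [noc], and the
   rest, by induction, a further [t]. *)
have [||j [jl bj]] := @big_list _ _ (chart_chain c) _ (iota 0 (size l))
    (fun j t1 => big (fun t => Th j t1 t)).
- by move=> j; rewrite /big; have dThj := dTh j; definable.
- apply: sub_big Hlarge => t1 [h [ht1 Hl]].
  apply: (@big_list _ _ J _ (iota 0 (size l)) (fun j t => Th j t1 t)).
    by move=> j; have dThj := dTh j; definable.
  apply: contrapT => nb; have [|L HL] := @nbig_fin _ _ J (fun t => exists j, List.In j (iota 0 (size l)) /\ Th j t1 t) _ nb.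
    suff H s : dset (fun t => exists j, List.In j s /\ Th j t1 t) by exact: H.
    elim: s => [|j s IHs].
      by apply: dfn_ext (dfn_false D) => v; split=> // -[? []].
    apply: (@dfn_ext _ _ (fun v => Th j t1 (code J (v 0)) \/ (fun t => exists j, List.In j s /\ Th j t1 t) (code J (v 0)))).
      move=> v; split=> [[?|[i [? ?]]]|[i [[->|?] ?]]]; [by exists j; split=> //; left|
       by exists i; split=> //; right|by left|by right; exists i].
    by have dThj := dTh j; definable.
  have dL := within_def L.
  have [||H|H] := @large_or (fun x => X x /\ within L (p x))
      (fun x => X x /\ ~ within L (p x)) l (g ⋅ h).
  + by definable.
  + by apply: sub_large Hl => x Xx; have [?|?] := pselect (within L (p x)); [left|right].
  + have [||t [tL Ht]] := @large_list _ L (fun t x => X x /\ p x = t) l (g ⋅ h).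
    * by move=> t; definable.
    * by apply: sub_large H => x [Xx Lx]; exists (p x).
    * by apply: noc; exists t1, h, t.
  + have [|j [t [h' [jl sh' Hj]]]] := IH _ _ _ cl El H; first by definable.
    have [x [[_ nx] pxt]] := large_ex Hj; apply: nx; rewrite /within pxt.
    apply: HL; exists j; split; first by apply/In_iota.
    (* By [compat], multiplying by [h'] keeps the relation of [c] to [t1]. *)
    exists (h ⋅ h'); split; first by apply: sh' ht1; exact: compc.
    by rewrite gmulA; apply: sub_large Hj => y [[]].
(* Exchanging [t1] and [t] gives one fibre that is large for [c :: remove_at j l]. *)
have [|t bt] := @fubini _ _ _ _ (Th j) _ bj; first by [].
exists j.+1, t, gone; split; last by rewrite gmulg1.
  by move/In_iota: jl.
by move=> c0 _; exact: cstab1.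
Qed.

(** Each level costs one chart by [large_fiber]. Below the last level all points [g0 ⋅ (h ⋅ h')]
    equal [w], so the outermost chart only takes its finitely many values at [g0^^-1 ⋅ w] and cannot
    be big. *)
Lemma tower_bound n E l : tower n E -> compat l ->
  (exists g, large l (fun=> True) g) -> size l <= n.+1.
Proof.
move=> tw cl [g Hg].
have key m : forall i w X l g, i + m = n.+1 -> dset X -> (forall x, X x -> E i w x) ->
    compat l -> large l X g -> size l <= m.
  elim: m => [|m IH] i w X l0 g0 im dX XE cl0 H0.
    rewrite addn0 in im; case: l0 cl0 H0 => [//|c l0] [compc _] /= H0.
    have [L HL] := chart_fin c (g0^^-1 ⋅ w).
    exfalso; apply: (@fin_nbig _ _ _ _ L HL); apply: sub_big H0 => t [h [ht]].
    move=> /large_point[h' [sh' /XE]]; rewrite im => /(tower_eq tw) ->.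
    by rewrite -gmulA gmulKg; apply: sh' ht.
  have i_n : i <= n by rewrite -ltnS -im addnS ltnS leq_addr.
  have [J [p [dp Hp]]] := tower_chain tw w i_n.
  have [->//|El] := pselect (l0 = [::]).
  have [j [t [h [jl _ Hj]]]] := large_fiber dp dX cl0 El H0.
  have [y [Xy pyt]] := large_ex Hj.
  rewrite (size_remove_at jl) ltnS.
  apply: (IH i.+1 y _ _ _ _ _ _ _ Hj); first by rewrite addSnnS.
  - by definable.
  - by move=> x [Xx pxt]; apply: Hp; [exact: XE|exact: XE|rewrite pxt].
  - exact: compat_remove_at.
have [L HL] := tower_fin tw.
have dE : drel (E 0) := tower_def tw (leq0n n).
have [||w [_ Hw]] := @large_list _ L (fun w x => E 0 w x) l g.
- by move=> w; definable.
- by apply: sub_large Hg => x _; exact: HL.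
by apply: (key n.+1 0 w _ _ _ _ _ _ cl Hw) => //; definable.
Qed.

End GroupTheory.

(** * Convex subgroups *)

Definition same_side U (o : lorder U) (s : seq U) (x y : U) : Prop :=
  forall z, List.In z s -> z ≺[o] x /\ z ≺[o] y \/ x ≺[o] z /\ y ≺[o] z.

Lemma choice_list U V (R : U -> V -> Prop) (l : seq U) :
  exists l', forall x, List.In x l -> (exists y, R x y) ->
    exists y, List.In y l' /\ R x y.
Proof.
elim: l => [|x l [l' IH]]; first by exists [::].
have [[y Ry]|H] := pselect (exists y, R x y); last first.
  by exists l' => z [<-//|]; exact: IH.
exists (y :: l') => z [<- _|zl Hz]; first by exists y; split=> //; left.
by have [w [? ?]] := IH z zl Hz; exists w; split=> //; right.
Qed.

(** By induction: a new point splits each piece in at most two, and [choice_list] picks a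
    representative of every nonempty half. *)
Lemma same_side_finite U (o : lorder U) (s : seq U) :
  exists l, forall x, List.In x s \/ exists y, List.In y l /\ same_side o s x y.
Proof.
elim: s => [|z s [l Hl]].
  have [[x0 _]|H] := pselect (exists x0 : U, True).
    by exists [:: x0] => x; right; exists x0; split=> //; left.
  by exists [::] => x; case: H; exists x.
have [l1 H1] := choice_list (fun y a => same_side o s y a /\ a ≺[o] z) l.
have [l2 H2] := choice_list (fun y a => same_side o s y a /\ z ≺[o] a) l.
exists (l1 ++ l2)%list => x.
have [?|[y [yl xy]]] := Hl x; first by left; right.
have yx : same_side o s y x by move=> w /xy; tauto.
have tr a : same_side o s y a -> same_side o s x a.
  by move=> ya w ws; case: (xy w ws) => -[? ?]; case: (ya w ws) => -[? ?];
    [left|ord|ord|right].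
case: (olt_total o x z) => [xz|->|zx]; [right|by left; left|right].
  have [|a [al [ya az]]] := H1 y yl; first by exists x.
  exists a; split; first by apply: List.in_or_app; left.
  by move=> w [<-|]; [right|exact: tr].
have [|a [al [ya az]]] := H2 y yl; first by exists x.
exists a; split; first by apply: List.in_or_app; right.
by move=> w [<-|]; [left|exact: tr].
Qed.

Section Subgroups.
Variables (T : Type) (D : defsys T) (G : ogroup D).
Implicit Types (x y z g h : G) (V W : G -> Prop).

Record csub V : Prop := Csub {
  csub_def : dset V;
  csub1 : V gone;
  csubM : forall x y, V x -> V y -> V (x ⋅ y);
  csubV : forall x, V x -> V x^^-1;
  csub_convex : forall x y z, V x -> V z -> x ≼[G] y -> y ≼[G] z -> V y }.

Definition nontrivial V : Prop := exists x, V x /\ x <> gone.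

Lemma csub_pos V : csub V -> nontrivial V -> exists x, V x /\ gone ≺[G] x.
Proof.
move=> cV [x [Vx x1]]; case: (olt_total G x gone) => [xn|//|xp].
  exists x^^-1; split; first exact: csubV.
  by rewrite -(gltl_iff _ _ x) gmulg1 gmulgV.
by exists x.
Qed.

(** Let [a] be the largest listed element of [V], and g > 1 in [V] but not in [W]. If a listed y <=
    a represented the coset of [a ⋅ g], then 1 < g <= [y^^-1 ⋅ (a ⋅ g)] would put [g] in the convex
    [W]. *)
Lemma csub_index V W : csub V -> csub W -> (forall x, W x -> V x) ->
  ~ (forall x, V x -> W x) -> ~ fin_mod (fun y x => W (y^^-1 ⋅ x)) V.
Proof.
move=> cV cW WV VW [l Hl].
have [g [Vg nWg gp]] : exists g, [/\ V g, ~ W g & gone ≺[G] g].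
  move/existsNP: VW => [g /not_implyP[Vg nWg]].
  case: (olt_total G g gone) => [gn|E|gp]; last by exists g.
    exists g^^-1; split; first exact: csubV.
      by move/(csubV cW); rewrite ginvK.
    by rewrite -(gltl_iff _ _ g) gmulg1 gmulgV.
  by case: nWg; rewrite E; exact: csub1.
have [a [[al Va] amax]] : exists a, ((gone = a \/ List.In a l) /\ V a) /\
    forall x, (gone = x \/ List.In x l) /\ V x -> x ≼[G] a.
  by apply: (@ex_max _ G (gone :: l) _ gone) => [x []//|]; split;
    [left|exact: csub1].
have Vag : V (a ⋅ g) by exact: csubM.
have [y [yl Wy]] := Hl _ Vag.
have Vy : V y.
  have -> : y = (a ⋅ g) ⋅ (y^^-1 ⋅ (a ⋅ g))^^-1.
    by rewrite ginvM ginvK gmulA gmulgV gmul1g.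
  by apply: csubM => //; apply: csubV => //; exact: WV.
apply: nWg; apply: (csub_convex cW (csub1 cW) Wy); first by ord.
move=> H; apply: (amax y (conj (or_intror yl) Vy)).
by rewrite -(gltl_iff _ _ y^^-1) gmulVg -(gltr_iff _ _ g) gmul1g -gmulA.
Qed.

(** The chart relates [h] to the boundary points of the trace of hW on a chain. Were all these in a
    finite set [s], each trace would be a union of pieces cut out by [s], so a nonempty one would
    contain one of finitely many chosen points. As each fibre meets finitely many cosets, so would
    [X]. *)
Lemma chart_ex n (E : nat -> G -> G -> Prop) V W : tower n E -> csub V -> csub W ->
  (forall x, W x -> V x) -> ~ (forall x, V x -> W x) ->
  exists c : chart G, [/\ big (fun t => exists h, c h t),
    forall h t, c h t -> V h & forall g, W g -> cstab c g].
Proof.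
move=> tw cV cW WV VW; pose R y x := W (y^^-1 ⋅ x).
have dV := csub_def cV; have dW := csub_def cW.
have dR : drel R by rewrite /R; definable.
have refR x : R x x by rewrite /R gmulVg; exact: csub1.
have symR x y : R x y -> R y x by move/(csubV cW); rewrite /R ginvM ginvK.
have trR x y z : R x y -> R y z -> R x z.
  by move=> xy yz; have := csubM cW xy yz; rewrite /R -gmulA gmulKVg.
have [J [p [X [dX dp XV nX finX]]]] :=
  tower_level tw refR dV (csub_index cV cW WV VW).
pose S h t := exists x, R h x /\ (X x /\ p x = t).
have dS : drel S by rewrite /S; definable.
pose r h t := V h /\ ~ loc_const (S h) t.
have dr : drel r by rewrite /r /loc_const; definable.
have finr h : exists l, forall t, r h t -> List.In t l.
  have [|l Hl] := @fin_boundary _ _ J (S h); first by definable.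
  by exists l => t [_ /Hl].
exists (Chart dr finr); split=> /=; last 2 first.
- by move=> h t [].
- move=> g Wg h t [Vh Ht]; split; first by apply: csubM => //; exact: WV.
  suff -> : S (h ⋅ g) = S h by [].
  have Rhg : R h (h ⋅ g) by rewrite /R gmulKg.
  apply/funext => u; apply/propext; split=> -[x [Rx Hx]]; exists x; split=> //.
    exact: trR Rx.
  exact: trR (symR _ _ Rhg) Rx.
apply: contrapT => nb.
have [|s Hs] := @nbig_fin _ _ J (fun t => exists h, r h t) _ nb.
  by definable.
have [l Hl] := same_side_finite J s.
(* [S x] has its boundary in [s], so it meets the finite set [s ++ l]. *)
have [u Hu] : fin_mod R (fun x => exists t, List.In t (s ++ l)%list /\ S x t).
  apply: fin_mod_list => t _; have [m Hm] := finX t; exists m.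
  move=> x [y [xy /Hm[z [zm zy]]]]; exists z; split=> //.
  exact: trR zy (symR _ _ xy).
apply: nX; exists u => x Xx; apply: Hu.
have Sx : S x (p x) by exists x.
have [ps|[t [tl side]]] := Hl (p x).
  by exists (p x); split=> //; apply: List.in_or_app; left.
exists t; split; first by apply: List.in_or_app; right.
have dSx : dset (S x) by definable.
have Hloc v : ~ (v ≺[J] p x) /\ ~ (t ≺[J] v) \/ ~ (p x ≺[J] v) /\ ~ (v ≺[J] t) ->
    loc_const (S x) v.
  move=> Hv; apply: contrapT => nloc.
  have vs : List.In v s by apply: Hs; exists x; split=> //; exact: XV.
  by case: Hv => -[? ?]; case: (side v vs) => -[].
have [pt|tp] := pselect (t ≺[J] p x).
  by rewrite (@loc_const_const _ _ J (S x) t (p x)) //; [ord|move=> v ? ?; apply: Hloc; right].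
by rewrite -(@loc_const_const _ _ J (S x) (p x) t) // => v ? ?; apply: Hloc; left.
Qed.

Lemma minimal_csub n (E : nat -> G -> G -> Prop) : tower n E -> (exists x : G, x <> gone) ->
  exists V, [/\ csub V, nontrivial V & forall W, csub W -> nontrivial W ->
    (forall x, W x -> V x) -> forall x, V x -> W x].
Proof.
move=> tw [g0 g01]; apply: contrapT => nmin.
(* The list found for [W] is extended by a chart for V/W; it stays compatible because the domains of
   the old charts lie in [W]. *)
have key N : forall V, csub V -> nontrivial V -> exists l,
    [/\ size l = N, compat l,
      (forall c : chart G, List.In c l -> forall h t, c h t -> V h)
      & forall g, large l (fun=> True) g].
  elim: N => [|N IH] V cV ntV; first by exists [::]; split.
  have [W [cW ntW WV VW]] : exists W, [/\ csub W, nontrivial W,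
      forall x, W x -> V x & ~ forall x, V x -> W x].
    apply: contrapT => H; apply: nmin; exists V; split=> // W cW ntW WV.
    by apply: contrapT => VW; apply: H; exists W; split.
  have [l [sl cl Hl Hlarge]] := IH W cW ntW.
  have [c [bc cdom cst]] := chart_ex tw cV cW WV VW.
  exists (c :: l); split=> //=.
  - by rewrite sl.
  - by split=> // c' c'l h t /(Hl c' c'l)/cst.
  - by move=> c' [<-|c'l h t /(Hl c' c'l)/WV]; first exact: cdom.
  - by move=> g; apply: sub_big bc => t [h ht]; exists h.
(* One chart more than the levels [0, ..., n] allow. *)
have [|| l [sl cl _ Hl]] := key n.+2 (fun=> True).
- by split=> //; exact: dfn_cst.
- by exists g0.
have := tower_bound tw cl (ex_intro _ gone (Hl gone)).
by rewrite sl ltnn.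
Qed.

End Subgroups.

(** * Minimal convex subgroups *)

Section IncreasingChains.
Variables (T : Type) (D : defsys T) (G : ogroup D).
Implicit Types (x y z g h : G) (V : G -> Prop).

Definition incr (K : chain D) (f : K -> G) p q : Prop :=
  forall s t, p ≺[K] s -> s ≺[K] t -> t ≺[K] q -> f s ≺[G] f t.

(** Finite fibres over a chain have a definable choice, their least element. It is injective, so
    [homogeneous] makes it increasing on an interval, if necessary after reversing the chain. *)
Lemma chain_in n (E : nat -> G -> G -> Prop) (B : G -> Prop) : tower n E ->
  dset B -> ~ (exists l, forall x, B x -> List.In x l) ->
  exists (K : chain D) (f : K -> G) p q, [/\ p ≺[K] q, drel (fun x t => x = f t),
    forall t, p ≺[K] t -> t ≺[K] q -> B (f t) & incr f p q].
Proof.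
move=> tw dB nB.
have [|J [pr [X [dX dp XB nX finX]]]] := @tower_level _ _ _ _ _ eq B tw (fun=> erefl) dB.
  move=> [l Hl]; apply: nB; exists l => x /Hl[y [yl <-]] //.
pose m t x := (X x /\ pr x = t) /\ forall y, X y /\ pr y = t -> x ≼[G] y.
have dm : drel m by rewrite /m; definable.
have mI t x y : m t x -> m t y -> x = y.
  by move=> [Hx mx] [Hy my]; have := mx _ Hy; have := my _ Hx; ord.
(* The value [gone] where no least element exists makes [f] total with a definable graph. *)
pose f t := if pselect (exists x, m t x) is left H then projT1 (cid H) else gone.
have fm t : (exists x, m t x) -> m t (f t).
  by rewrite /f; case: pselect => // H _; exact: (projT2 (cid H)).
have fN t : ~ (exists x, m t x) -> f t = gone by rewrite /f; case: pselect.
have df : drel (fun x t => x = f t).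
  have H : drel (fun x t => m t x \/ ~ (exists y, m t y) /\ x = gone) by definable.
  apply: dfn_ext H => v; move: (code G _) (code J _) => x t.
  split=> [[mx|[nm ->]]|->].
  - by apply: (mI t) => //; apply: fm; exists x.
  - by rewrite fN.
  - have [H|H] := pselect (exists y, m t y); first by left; exact: fm.
    by right; split=> //; exact: fN.
have [p [q [pq Hpq]]] : big (fun t => exists x, X x /\ pr x = t).
  apply: contrapT => nb.
  have [|L HL] := @nbig_fin _ _ J (fun t => exists x, X x /\ pr x = t) _ nb.
    by definable.
  have [l Hl] := fin_mod_list (fun t (_ : List.In t L) => finX t).
  by apply: nX; exists l => x Xx; apply: Hl; exists (pr x); split=> //; apply: HL; exists x.
have Hf t : p ≺[J] t -> t ≺[J] q -> X (f t) /\ pr (f t) = t.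
  move=> pt tq; have [x Hx] := Hpq t pt tq; have [l Hl] := finX t.
  have [|u [Hu mu]] := @ex_min _ G l (fun y => X y /\ pr y = t) x _ Hx.
    by move=> y /Hl[z [zl <-]].
  by have [|] := fm t; first by exists u.
have [|a [b [ab pa bq [H|H]]]] := @homogeneous _ _ J (fun s t => f s ≺[G] f t) p q _ pq.
- by definable.
- exists J, f, a, b; split=> //.
  by move=> t ta tb; apply: XB; apply: (Hf t _ _).1; ord.
- exists (rev_chain J), f, b, a; split=> //.
    by move=> t ta tb; apply: XB; apply: (Hf t _ _).1; rewrite /= in ta tb; ord.
  move=> s t bs st ta; rewrite /= in bs st ta.
  case: (olt_total G (f s) (f t)) => [//|E1|ts]; last by case: (H t s).
  have [_ Es] : X (f s) /\ pr (f s) = s by apply: Hf; ord.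
  have [_ Et] : X (f t) /\ pr (f t) = t by apply: Hf; ord.
  have E2 : s = t by rewrite -Es -Et E1.
  by exfalso; move: st; rewrite E2; exact: olt_irr.
Qed.

(* The cosets of this subgroup are too small to separate points of [f]. *)
Definition gap (K : chain D) (f : K -> G) p q g : Prop :=
  (forall s t, p ≺[K] s -> s ≺[K] t -> t ≺[K] q -> f s ⋅ g ≺[G] f t) /\
  (forall s t, p ≺[K] s -> s ≺[K] t -> t ≺[K] q -> f s ⋅ g^^-1 ≺[G] f t).

Lemma gap_csub (K : chain D) (f : K -> G) p q :
  drel (fun x t => x = f t) -> incr f p q -> csub (gap f p q).
Proof.
move=> df fI; split.
- by rewrite /gap; definable.
- have E1 : gone^^-1 = gone :> G by rewrite -[RHS](gmulgV gone) gmul1g.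
  by split=> s t ps st tq; rewrite ?E1 gmulg1; exact: fI.
(* An intermediate [u] separates the two factors: [f s ⋅ g ≺[G] f u] and [f u ⋅ h ≺[G] f t]. *)
- have H g h : (forall s t, p ≺[K] s -> s ≺[K] t -> t ≺[K] q -> f s ⋅ g ≺[G] f t) ->
    (forall s t, p ≺[K] s -> s ≺[K] t -> t ≺[K] q -> f s ⋅ h ≺[G] f t) ->
    (forall s t, p ≺[K] s -> s ≺[K] t -> t ≺[K] q -> f s ⋅ (g ⋅ h) ≺[G] f t).
    move=> Hg Hh s t ps st tq; have [u [su ut]] := cdense st.
    have uq : u ≺[K] q by ord.
    have pu : p ≺[K] u by ord.
    rewrite gmulA; apply: olt_trans (Hh u t pu ut tq); apply: gltr.
    exact: Hg.
  by move=> g h [g1 g2] [h1 h2]; split; [|rewrite ginvM]; apply: H.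
- by move=> g [g1 g2]; split=> //; rewrite ginvK.
- move=> x y z [x1 x2] [z1 z2] xy yz; split=> s t ps st tq.
    apply: ole_lt_trans (z1 s t ps st tq); by rewrite gltl_iff.
  apply: ole_lt_trans (x2 s t ps st tq); by rewrite gltl_iff gltV.
Qed.

End IncreasingChains.

Definition minimal (T : Type) (D : defsys T) (G : ogroup D) (V : G -> Prop) :=
  [/\ csub V, nontrivial V & forall W, csub W -> nontrivial W ->
    (forall x, W x -> V x) -> forall x, V x -> W x].

(** * Gaps of increasing maps into a minimal convex subgroup *)

Section Gaps.
Variables (T : Type) (D : defsys T) (G : ogroup D) (V : G -> Prop).
Hypothesis minV : minimal V.
Implicit Types (x y z g h : G).

(** The elements of the gap subgroup lie between [d^^-1] and [d], where [d] is [(f s)^^-1 ⋅ f t],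
    hence in [V]. Were it nontrivial, it would be [V] by minimality; but it omits [d], since
    [f s ⋅ d = f t]. *)
Lemma gap_trivial (K : chain D) (f : K -> G) p q g : p ≺[K] q ->
  drel (fun x t => x = f t) -> incr f p q ->
  (forall t, p ≺[K] t -> t ≺[K] q -> V (f t)) -> gap f p q g -> g = gone.
Proof.
move=> pq df fI fV gapg; apply: contrapT => g1.
have [cV _ mV] := minV.
have [s [ps sq]] := cdense pq; have [t [st tq]] := cdense sq.
have pt : p ≺[K] t by ord.
pose d := (f s)^^-1 ⋅ f t.
have Vd : V d by apply: (csubM cV); [apply: (csubV cV)|]; exact: fV.
have : gap f p q d.
  apply: (mV _ (gap_csub df fI)) => //; first by exists g.
  move=> h [h1 h2]; apply: (csub_convex cV (csubV cV Vd) Vd).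
    apply: oltW; rewrite -(ginvK h) gltV -(gltl_iff _ _ (f s)) /d gmulKVg.
    exact: h2.
  by apply: oltW; rewrite -(gltl_iff _ _ (f s)) /d gmulKVg; exact: h1.
by move=> [/(_ s t ps st tq)]; rewrite /d gmulKVg => H0 _; exact: (olt_irr H0).
Qed.

(** The sets [d t] of sizes fitting into the gap after [f t] are initial segments of the positive
    elements, hence comparable; by [homogeneous] they grow or shrink with [t] on an interval. Either
    way one [g] lies in all [d t] of a subinterval, and so in a gap subgroup. *)
Lemma no_right_gap (K : chain D) (f : K -> G) p q :
  drel (fun x t => x = f t) -> incr f p q ->
  (forall t, p ≺[K] t -> t ≺[K] q -> V (f t)) ->
  ~ big (fun t => (p ≺[K] t /\ t ≺[K] q) /\ exists h, f t ≺[G] h /\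
      forall t', t ≺[K] t' -> t' ≺[K] q -> h ≺[G] f t').
Proof.
move=> df fI fV [a [b [ab Hab]]].
pose d t g := gone ≺[G] g /\ forall t', t ≺[K] t' -> t' ≺[K] q -> f t ⋅ g ≺[G] f t'.
have dd : drel d by rewrite /d; definable.
have exd t : a ≺[K] t -> t ≺[K] b -> exists g, d t g.
  move=> ta tb; have [_ [h [th Hh]]] := Hab t ta tb.
  exists ((f t)^^-1 ⋅ h); split; first by rewrite -(gltl_iff _ _ (f t)) gmulKVg gmulg1.
  by rewrite gmulKVg.
have main a1 b1 g : a1 ≺[K] b1 -> a ≼[K] a1 -> b1 ≼[K] b ->
    (forall t, a1 ≺[K] t -> t ≺[K] b1 -> d t g) -> False.
  move=> a1b1 aa1 b1b dg.
  have sub t : a1 ≺[K] t -> t ≺[K] b1 -> p ≺[K] t /\ t ≺[K] q.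
    by move=> ta tb; apply: (Hab t _ _).1; ord.
  have [t0 [at0 tb0]] := cdense a1b1; have [gp _] := dg t0 at0 tb0.
  suff E1 : g = gone by move: gp; rewrite E1 => H0; exact: (olt_irr H0).
  apply: (@gap_trivial K f a1 b1) => //.
  - by move=> s t as_ st tb; apply: fI => //; [apply: (sub s _ _).1|apply: (sub t _ _).2]; ord.
  - by move=> t ta tb; have [? ?] := sub t ta tb; exact: fV.
  split=> s t as_ st tb.
    have [_] : d s g by apply: dg; ord.
    by apply=> //; apply: (sub t _ _).2; ord.
  have st' : f s ≺[G] f t.
    by apply: fI => //; [apply: (sub s _ _).1|apply: (sub t _ _).2]; ord.
  apply: olt_trans st'; rewrite -[X in _ ≺[G] X]gmulg1 gltl_iff.
  by rewrite -(gltl_iff _ _ g) gmulgV gmulg1.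
have [|a1 [b1 [a1b1 aa1 b1b [H|H]]]] :=
    @homogeneous _ _ K (fun s t => forall g, d s g -> d t g) a b _ ab.
- by definable.
- have [t0 [at0 tb0]] := cdense a1b1.
  have [g dg] : exists g, d t0 g by apply: exd; ord.
  apply: (main t0 b1 g) => //; first ord.
  by move=> t t0t tb1; apply: H dg.
have [t0 [at0 tb0]] := cdense a1b1.
have [g dg] : exists g, d t0 g by apply: exd; ord.
apply: (main a1 t0 g) => //; first ord.
move=> t a1t tt0; have /existsNP[g' /not_implyP[[g'p dg'] ndg']] := H t t0 a1t tt0 tb0.
split=> [|t' tt' t'q]; first by case: dg.
apply: olt_trans (dg' t' tt' t'q); rewrite gltl_iff.
apply: contrapT => g'g; apply: ndg'; split=> // u t0u uq.
have [_ /(_ u t0u uq)] := dg; apply: ole_lt_trans.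
by rewrite gltl_iff.
Qed.

End Gaps.

Definition rev_group (T : Type) (D : defsys T) (G : ogroup D) : ogroup D.
Proof.
apply: (@OGroup _ _ G (rev_order G) (@gmul _ _ G) gone (@ginv _ _ G)).
- by rewrite /=; definable.
- exact: gmul_def.
- exact: ginv_def.
- exact: gmulA.
- exact: gmul1g.
- exact: gmulg1.
- exact: gmulVg.
- exact: gmulgV.
- by move=> x y z; exact: gltl.
- by move=> x y z; exact: gltr.
Defined.

Lemma rev_csub (T : Type) (D : defsys T) (G : ogroup D) (V : G -> Prop) :
  csub V -> @csub _ _ (rev_group G) V.
Proof.
move=> [dV V1 VM VV Vc]; split=> // x y z Vx Vz xy yz.
exact: (Vc z y x).
Qed.

Lemma rev_minimal (T : Type) (D : defsys T) (G : ogroup D) (V : G -> Prop) :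
  minimal V -> @minimal _ _ (rev_group G) V.
Proof.
move=> [cV ntV mV]; split=> //; first exact: rev_csub.
move=> W [dW W1 WM WV Wc]; apply: mV; split=> // x y z Wx Wz xy yz.
exact: (Wc z y x).
Qed.

(** Reversing both the chain and the group keeps [f] increasing and turns left gaps into right
    ones. *)
Lemma no_left_gap (T : Type) (D : defsys T) (G : ogroup D) (V : G -> Prop)
    (K : chain D) (f : K -> G) p q : minimal V ->
  drel (fun x t => x = f t) -> incr f p q ->
  (forall t, p ≺[K] t -> t ≺[K] q -> V (f t)) ->
  ~ big (fun t => (p ≺[K] t /\ t ≺[K] q) /\ exists h, h ≺[G] f t /\
      forall t', p ≺[K] t' -> t' ≺[K] t -> f t' ≺[G] h).
Proof.
move=> /rev_minimal minV df fI fV /(@big_rev _ _ K) H.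
apply: (@no_right_gap _ _ _ _ minV (rev_chain K) f q p df).
- by move=> s t qs st tp; exact: fI.
- by move=> t qt tp; exact: fV.
apply: sub_big H => t [[pt tq] [h [ht Hh]]]; split; first by split.
by exists h; split=> // t' tt' t'p; exact: Hh.
Qed.

(** * O-minimality of a minimal convex subgroup *)

Section Minimal.
Variables (T : Type) (D : defsys T) (G : ogroup D) (V : G -> Prop).
Variables (n : nat) (E : nat -> G -> G -> Prop).
Hypothesis tw : tower n E.
Hypothesis minV : minimal V.
Implicit Types (x y z g h : G) (B : G -> Prop).

Let cV : csub V. Proof. by case: minV. Qed.

Lemma minimal_infinite : ~ exists l, forall x, V x -> List.In x l.
Proof.
move=> [l Hl]; have [_ ntV _] := minV; have [g [Vg gp]] := csub_pos cV ntV.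
have [m [Vm Hm]] := ex_max G Hl Vg.
apply: (Hm (m ⋅ g)); first exact: (csubM cV).
by rewrite -[X in X ≺[G] _]gmulg1 gltl_iff.
Qed.

(* Without gaps the image of [f] is convex, as [K] is definably complete. *)
Lemma convex_chain : exists (K : chain D) (f : K -> G) a b,
  [/\ a ≺[K] b, drel (fun x t => x = f t),
    forall t, a ≼[K] t -> t ≼[K] b -> V (f t),
    forall s t, a ≼[K] s -> s ≺[K] t -> t ≼[K] b -> f s ≺[G] f t
    & forall g, f a ≺[G] g -> g ≺[G] f b ->
        exists t, [/\ a ≺[K] t, t ≺[K] b & f t = g]].
Proof.
have [K [f [p [q [pq df fV fI]]]]] :=
  chain_in tw (csub_def cV) minimal_infinite.
pose Rg t := exists h, f t ≺[G] h /\
  forall t', t ≺[K] t' -> t' ≺[K] q -> h ≺[G] f t'.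
pose Lg t := exists h, h ≺[G] f t /\
  forall t', p ≺[K] t' -> t' ≺[K] t -> f t' ≺[G] h.
have [p' [q' [pq' Hpq]]] :
    big (fun t => ((p ≺[K] t /\ t ≺[K] q) /\ ~ Rg t) /\ ~ Lg t).
  have dRg : dset Rg by rewrite /Rg; definable.
  have dLg : dset Lg by rewrite /Lg; definable.
  have [||/(no_right_gap minV df fI fV)//|H1] := @big_or _ _ K
      (fun t => (p ≺[K] t /\ t ≺[K] q) /\ Rg t)
      (fun t => (p ≺[K] t /\ t ≺[K] q) /\ ~ Rg t).
  - by definable.
  - exists p, q; split=> // t pt tq.
    by have [?|?] := pselect (Rg t); [left|right].
  have [||/(no_left_gap minV df fI fV)//|//] := @big_or _ _ K
      (fun t => (p ≺[K] t /\ t ≺[K] q) /\ Lg t)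
      (fun t => ((p ≺[K] t /\ t ≺[K] q) /\ ~ Rg t) /\ ~ Lg t).
  - by definable.
  apply: sub_big H1 => t [? ?].
  by have [?|?] := pselect (Lg t); [left|right].
(* Taken strictly inside, so that [f] has no gap at [a] and [b] either. *)
have [a [pa aq]] := cdense pq'; have [b [ab bq]] := cdense aq.
have sub t : a ≼[K] t -> t ≼[K] b -> p ≺[K] t /\ t ≺[K] q.
  by move=> at' tb; apply: (Hpq t _ _).1.1; ord.
have fI' s t : a ≼[K] s -> s ≺[K] t -> t ≼[K] b -> f s ≺[G] f t.
  by move=> as_ st tb; apply: fI => //; [apply: (sub s _ _).1|apply: (sub t _ _).2]; ord.
exists K, f, a, b; split=> //.
  by move=> t ta tb; have [? ?] := sub t ta tb; exact: fV.
move=> g ag gb.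
have [||||s [as_ sb dn up]] :=
  @chain_cut _ _ K (fun u => u ≼[K] a \/ u ≺[K] b /\ f u ≺[G] g) a b.
- by definable.
- move=> u w uw [wa|[wb wg]]; first by left; ord.
  have [au|ua] := pselect (a ≺[K] u); last by left.
  right; split; first ord.
  by apply: olt_trans wg; apply: fI' => //; ord.
- by left; exact: olt_irr.
- by move=> [H|[H _]]; [exact: H|exact: (olt_irr H)].
have [ps sq] : p ≺[K] s /\ s ≺[K] q by exact: sub.
have [[_ nR] nL] := Hpq s ltac:(ord) ltac:(ord).
apply: contrapT => nog.
have nof t : a ≺[K] t -> t ≺[K] b -> f t <> g.
  by move=> at' tb E1; apply: nog; exists t.
(* At the end point [s] of the cut made by [g], a value below [g] exhibits a right gap and one above
   [g] a left gap. *)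
case: (olt_total G (f s) g) => [sg|Es|gs].
- have sb' : s ≺[K] b.
    by case: (olt_total K s b) => [//|E1|//]; move: sg; rewrite E1; ord.
  apply: nR; exists g; split=> // t st tq.
  have [tb|bt] := pselect (t ≺[K] b); last first.
    case: (olt_total K b t) => [bt'|<-//|//].
    by apply: olt_trans gb _; apply: fI => //; apply: (sub b _ _).1; ord.
  case: (olt_total G g (f t)) => [//|E1|tg]; first by case: (nof t _ tb) => //; ord.
  by case: (up t st); right.
- case: (olt_total K a s) => [as'|E1|//]; last by move: ag; rewrite E1 Es => H0; case: (olt_irr H0).
  case: (olt_total K s b) => [sb'|E1|//]; last by move: gb; rewrite -E1 Es => H0; case: (olt_irr H0).
  exact: nof Es.
have as' : a ≺[K] s.
  by case: (olt_total K a s) => [//|E1|//]; move: ag; rewrite E1; ord.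
apply: nL; exists g; split=> // t pt ts.
have [at'|ta] := pselect (a ≺[K] t).
  by case: (dn t ts) => [|[]].
case: (olt_total K t a) => [ta'|->//|//].
by apply: olt_trans ag; apply: fI => //; apply: (sub a _ _).2; ord.
Qed.

Definition gloc B y : Prop := exists u w, (u ≺[G] y /\ y ≺[G] w) /\
  forall z, u ≺[G] z -> z ≺[G] w -> (B z <-> B y).

(* Some interval ]1, r[ of [V], hence each of its translates, is o-minimal. *)
Lemma local_ominimality : exists r, [/\ V r, gone ≺[G] r,
    forall x y, x ≺[G] y -> exists z, x ≺[G] z /\ z ≺[G] y,
    forall B x, dset B -> exists l, forall y, x ≺[G] y -> y ≺[G] x ⋅ r ->
      ~ gloc B y -> List.In y l
  & forall B x, dset B -> (forall y z, y ≺[G] z -> B z -> B y) ->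
      B x -> ~ B (x ⋅ r) -> exists s, (forall y, y ≺[G] s -> B y) /\
        (forall y, s ≺[G] y -> ~ B y)].
Proof.
have [K [f [a [b [ab df fV fI fonto]]]]] := convex_chain.
have aa := @olt_irr _ K a; have bb := @olt_irr _ K b.
have ab' : a ≼[K] b by ord.
pose r := (f a)^^-1 ⋅ f b.
(* Left translation by [x ⋅ (f a)^^-1] carries the image of [[a, b]] onto the interval from [x] to
   [x ⋅ r]; density, finite boundary and end points of cuts are transported along [tr x]. *)
pose tr x t := x ⋅ ((f a)^^-1 ⋅ f t).
have tra x : tr x a = x by rewrite /tr gmulVg gmulg1.
have trb x : tr x b = x ⋅ r by [].
have trI x s t : a ≼[K] s -> s ≺[K] t -> t ≼[K] b -> tr x s ≺[G] tr x t.
  by move=> *; rewrite !gltl_iff; exact: fI.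
have tr_onto x g : x ≺[G] g -> g ≺[G] x ⋅ r ->
    exists t, [/\ a ≺[K] t, t ≺[K] b & tr x t = g].
  move=> xg gr; have [||t [at' tb ft]] := fonto (f a ⋅ (x^^-1 ⋅ g)).
  - rewrite -[X in X ≺[G] _]gmulg1 gltl_iff -(gltl_iff _ _ x).
    by rewrite gmulg1 gmulKVg.
  - by rewrite -(gltl_iff _ _ (f a)^^-1) gmulKg -(gltl_iff _ _ x) gmulKVg.
  by exists t; split=> //; rewrite /tr ft gmulKg gmulKVg.
have tr_lt x s t : a ≼[K] s -> s ≼[K] b -> a ≼[K] t -> t ≼[K] b ->
    tr x s ≺[G] tr x t -> s ≺[K] t.
  move=> as_ sb at' tb H; case: (olt_total K s t) => [//|E1|ts].
    by move: H; rewrite E1 => H0; case: (olt_irr H0).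
  by have := trI x t s at' ts sb; ord.
exists r; split.
- by apply: (csubM cV); [apply: (csubV cV)|]; apply: fV.
- by rewrite -(gltl_iff _ _ (f a)) gmulg1 gmulKVg; exact: fI.
- move=> x y xy.
  have [c [ac cb cy]] : exists c, [/\ a ≺[K] c, c ≼[K] b & tr x c ≼[G] y].
    have [yr|ry] := pselect (y ≺[G] x ⋅ r); last by exists b; split.
    have [t [at' tb ft]] := tr_onto x y xy yr; exists t; split=> //; first ord.
    by rewrite ft; exact: olt_irr.
  have [t [at' tc]] := cdense ac; exists (tr x t); split.
    by rewrite -[X in X ≺[G] _](tra x); apply: trI => //; ord.
  by apply: olt_le_trans cy; apply: trI => //; ord.
- move=> B x dB; pose B' t := B (tr x t).
  have dB' : dset B' by rewrite /B' /tr; definable.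
  have [L HL] := fin_boundary dB'.
  exists (List.map (tr x) L) => y xy yr ny.
  have [t [at' tb ft]] := tr_onto x y xy yr.
  rewrite -ft; apply: List.in_map; apply: HL => -[locR locL]; apply: ny.
  have [w0 [tw0 Hw0]] := locR b tb; have [u0 [u0t Hu0]] := locL a at'.
  have [w [tw' wb ww0]] : exists w, [/\ t ≺[K] w, w ≼[K] b & w ≼[K] w0].
    by have [?|?] := pselect (w0 ≺[K] b); [exists w0|exists b]; split=> //; ord.
  have [u [ut au uu0]] : exists u, [/\ u ≺[K] t, a ≼[K] u & u0 ≼[K] u].
    by have [?|?] := pselect (a ≺[K] u0); [exists u0|exists a]; split=> //; ord.
  exists (tr x u), (tr x w); split.
    by rewrite -ft; split; apply: trI => //; ord.
  move=> z uz zw.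
  have [||s [as_ sb fs]] := tr_onto x z.
  - apply: ole_lt_trans uz; case: (olt_total K a u) => [au'|<-|//]; last by rewrite tra; exact: olt_irr.
    by apply: oltW; rewrite -[X in X ≺[G] _](tra x); apply: trI => //; ord.
  - apply: olt_le_trans zw _; rewrite -trb.
    case: (olt_total K w b) => [wb'|->|//]; last exact: olt_irr.
    by apply: oltW; apply: trI => //; ord.
  rewrite -fs -ft; move: uz zw; rewrite -fs => us sw.
  have {}us : u ≺[K] s by apply: (tr_lt x) => //; ord.
  have {}sw : s ≺[K] w by apply: (tr_lt x) => //; ord.
  case: (olt_total K s t) => [st|->//|ts]; first by apply: Hu0; ord.
  by apply: Hw0; ord.
- move=> B x dB dn Bx nBr.
  have [||||s [as_ sb dn' up]] :=
    @chain_cut _ _ K (fun t => t ≼[K] a \/ t ≺[K] b /\ B (tr x t)) a b.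
  + by rewrite /tr; definable.
  + move=> s t st [ta|[tb Bt]]; first by left; ord.
    have [as_|sa] := pselect (a ≺[K] s); last by left.
    right; split; first ord.
    by apply: dn Bt; apply: trI => //; ord.
  + by left.
  + by move=> [H|[H _]]; [exact: H|exact: (olt_irr H)].
  exists (tr x s); split=> y.
    move=> ys; have [xy|yx] := pselect (x ≺[G] y); last first.
      by case: (olt_total G y x) => [/dn|->|//]; exact.
    have [|t [at' tb ft]] := tr_onto x y xy.
      apply: olt_le_trans ys _; rewrite -trb.
      case: (olt_total K s b) => [sb'|->|//]; last exact: olt_irr.
      by apply: oltW; apply: trI => //; ord.
    have ts : t ≺[K] s by apply: (tr_lt x) => //; [ord|ord|rewrite ft].
    by rewrite -ft; case: (dn' t ts) => [|[]].
  move=> sy By; have [yr|ry] := pselect (y ≺[G] x ⋅ r); last first.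
    by apply: nBr; case: (olt_total G (x ⋅ r) y) => [/dn|->|//]; exact.
  have [|t [at' tb ft]] := tr_onto x y _ yr.
    apply: ole_lt_trans sy; case: (olt_total K a s) => [as'|<-|//]; last by rewrite tra; exact: olt_irr.
    by apply: oltW; rewrite -[X in X ≺[G] _](tra x); apply: trI => //; ord.
  have st : s ≺[K] t by apply: (tr_lt x) => //; [ord|ord|rewrite ft].
  by apply: (up t st); right; split=> //; rewrite ft.
Qed.

Theorem minimal_ominimal B : dset B -> (forall x, B x -> V x) ->
  exists l, forall x y, V x -> V y -> x ≼[G] y ->
    (forall z, List.In z l -> z ≺[G] x \/ y ≺[G] z) -> (B x <-> B y).
Proof.
move=> dB BV; have [r [Vr rp gdense LO cut]] := local_ominimality.
have [dV V1 VM VV Vc] := cV.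
have dloc : dset (fun y => V y /\ ~ gloc B y) by rewrite /gloc; definable.
have [l Hl] : exists l, forall y, V y /\ ~ gloc B y -> List.In y l.
  apply: contrapT => nfin.
  have [K [f [p [q [pq df fB fI]]]]] := chain_in tw dloc nfin.
  suff r1 : r = gone by move: rp; rewrite r1 => H0; case: (olt_irr H0).
  apply: (gap_trivial minV pq df fI); first by move=> t pt tq; case: (fB t pt tq).
  (* Infinitely many boundary points [f u] lie between [f s] and [f t], but only finitely many
     between [f s] and [f s ⋅ r]. *)
  have st_r s t : p ≺[K] s -> s ≺[K] t -> t ≺[K] q -> f s ⋅ r ≺[G] f t.
    move=> ps st tq; apply: contrapT => ts; have [L HL] := LO B (f s) dB.
    have [|L' HL'] := @fin_image _ _ (fun x u => x = f u /\ (s ≺[K] u /\ u ≺[K] t)) L.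
      move=> x u w [-> [su ut]] [E1 [sw wt]].
      case: (olt_total K u w) => [uw|//|wu].
        have : f u ≺[G] f w by apply: fI => //; ord.
        by rewrite E1 => H0; case: (olt_irr H0).
      have : f w ≺[G] f u by apply: fI => //; ord.
      by rewrite E1 => H0; case: (olt_irr H0).
    apply: (@fin_nbig _ _ K (fun u => s ≺[K] u /\ u ≺[K] t) L').
      move=> u [su ut]; apply: (HL' (f u)) => //.
      have fsu : f s ≺[G] f u by apply: fI => //; ord.
      have fut : f u ≺[G] f t by apply: fI => //; ord.
      apply: HL => //; first ord.
      by apply: (fB u _ _).2; ord.
    by exists s, t; split.
  split=> s t ps st tq; first exact: st_r.
  apply: olt_trans (fI s t ps st tq).
  by rewrite -[X in _ ≺[G] X]gmulg1 gltl_iff -(gltl_iff _ _ r) gmulgV gmulg1.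
exists l => x z Vx Vz xz lxz.
have Hloc y : x ≼[G] y -> y ≼[G] z -> gloc B y.
  move=> xy yz; apply: contrapT => ny.
  have Vy : V y by exact: Vc Vx Vz xy yz.
  by have [] := lxz y (Hl y (conj Vy ny)); ord.
apply: contrapT => nxz.
(* An initial segment, vacuously containing everything below [x]; local constancy of [B] from [x] to
   [z] forbids it an end point. *)
pose C y := forall u, x ≼[G] u -> u ≼[G] y -> (B u <-> B x).
have dC : dset C by rewrite /C; definable.
have dn y y' : y ≺[G] y' -> C y' -> C y by move=> yy' Cy' u xu uy; apply: Cy' => //; ord.
have dn' y y' : y ≼[G] y' -> C y' -> C y.
  by move=> yy'; case: (olt_total G y y') => [/dn|->|//]; auto.
have Cx : C x by move=> u xu ux; have -> : u = x by ord.
have nCz : ~ C z.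
  by move=> /(_ z xz (@olt_irr _ G z)) ?; apply: nxz; symmetry.
have nocut s : (forall y, y ≺[G] s -> C y) -> (forall y, s ≺[G] y -> ~ C y) -> False.
  move=> Cs nCs.
  have xs : x ≼[G] s by move=> sx; exact: nCs sx Cx.
  have sz : s ≼[G] z by move=> zs; apply: nCz; exact: Cs.
  have [u0 [w [[us sw] Hs]]] := Hloc s xs sz.
  have [C_s|nC_s] := pselect (C s).
    have [y [sy yw]] := gdense _ _ sw; apply: (nCs y sy) => v xv vy.
    have [sv|vs] := pselect (s ≺[G] v); last exact: C_s.
    by rewrite (Hs v) //; [apply: C_s => //; exact: olt_irr|ord|ord].
  have xs' : x ≺[G] s.
    by case: (olt_total G x s) => [//|E1|//]; case: nC_s; rewrite -E1.
  have [y [xy uy ys]] : exists y, [/\ x ≺[G] y, u0 ≺[G] y & y ≺[G] s].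
    have [xu|ux] := pselect (x ≺[G] u0).
      by have [y [? ?]] := gdense _ _ us; exists y; split=> //; ord.
    by have [y [? ?]] := gdense _ _ xs'; exists y; split=> //; ord.
  apply: nC_s => v xv vs; case: (olt_total G v s) => [vs'|->|//].
    by apply: (Cs v vs') => //; exact: olt_irr.
  by rewrite -(Hs y) //; [apply: (Cs y ys) => //; ord|ord].
have Cr y : C y -> C (y ⋅ r).
  by move=> Cy; apply: contrapT => nCy; have [s [? ?]] := cut C y dC dn Cy nCy; exact: (nocut s).
(* The right stabilizer of [C] contains [r] and lies in [V], because [x] is in [C] and [z] is not.
   By minimality it contains [x^^-1 ⋅ z], which moves [x] to [z]. *)
pose W g := forall y, C y <-> C (y ⋅ g).
have cW : csub W.
  split.
  - by rewrite /W; definable.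
  - by move=> y; rewrite gmulg1.
  - by move=> g h Wg Wh y; rewrite gmulA -Wh -Wg.
  - by move=> g Wg y; rewrite (Wg (y ⋅ g^^-1)) gmulgKV.
  - move=> g1 g g2 W1 W2 g1g gg2 y; split.
      by move/(W2 y); apply: dn'; rewrite gltl_iff.
    by move=> H; apply/(W1 y); apply: dn' H; rewrite gltl_iff.
have Wr : W r.
  move=> y; split; first exact: Cr.
  by apply: dn; rewrite -[X in X ≺[G] _]gmulg1 gltl_iff.
have WVp g : W g -> gone ≺[G] g -> V g.
  move=> Wg gp; apply: (Vc gone g (x^^-1 ⋅ z)) => //.
  - by apply: VM => //; exact: VV.
  - by ord.
  rewrite -(gltl_iff _ _ x) gmulKVg => zx; apply: nCz; apply: dn zx _.
  by apply/(Wg x).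
have WV g : W g -> V g.
  move=> Wg; case: (olt_total G gone g) => [|<-//|gn]; first exact: WVp.
  rewrite -(ginvK g); apply: VV; apply: WVp; first exact: (csubV cW).
  by rewrite -(gltl_iff _ _ g) gmulg1 gmulgV.
have [_ _ mV] := minV.
have Wd : W (x^^-1 ⋅ z).
  apply: mV => //; first by exists r; split=> // r1; move: rp; rewrite r1 => H0; case: (olt_irr H0).
  by apply: VM => //; exact: VV.
by apply: nCz; have := (Wd x).1 Cx; rewrite gmulKVg.
Qed.

End Minimal.

(** * Back to first-order structures *)

Lemma finite_list U (A : set U) :
  finite_set A -> exists l, forall x, A x -> List.In x l.
Proof.
elim/Pchoice: U => U in A *; move=> /finite_seqP[s ->]; exists s => x /=.
by elim: s => //= y s IH; rewrite inE => /predU1P[->|/IH]; [left|right].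
Qed.

Lemma list_finite U (A : set U) (l : seq U) :
  (forall x, A x -> List.In x l) -> finite_set A.
Proof.
move=> Al; apply: (@sub_finite_set _ _ [set x | List.In x l]) => //.
elim: l {Al} => [|y l IH] /=; first by apply: sub_finite_set (finite_set0 U).
have -> : [set x | y = x \/ List.In x l] = [set y] `|` [set x | List.In x l].
  by apply/seteqP; split=> x /= [->|?]; [left|right|left|right].
by rewrite finite_setU; split.
Qed.

Lemma sval_inj U (P : U -> Prop) (a b : {x | P x}) : sval a = sval b -> a = b.
Proof.
case: a b => [a pa] [b pb] /= E; rewrite -E in pb *; congr exist.
exact: Prop_irrelevance.
Qed.

Definition sub_order U (X : set U) lt (H : linear_order_on X lt) :
  lorder {x | X x}.
Proof.
exists (fun a b => lt (sval a) (sval b)) => [[x Xx]|[x Xx] [y Xy] [z Xz]|] /=.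
- exact: (lin_irr H).
- exact: (lin_trans H).
- move=> a b; have [?|?|?] := lin_total H (proj2_sig a) (proj2_sig b).
  + by constructor 1.
  + by constructor 2; exact: sval_inj.
  + by constructor 3.
Defined.

(** * Finite unions of intervals versus finite lists of separating points *)

Section FiniteUnions.
Variables (U : Type) (X : set U) (lt : U -> U -> Prop).
Hypothesis linX : linear_order_on X lt.
Let o := sub_order linX.

Lemma finite_union_list (A : set U) :
  finite_union_of_intervals_and_points X lt A ->
  exists l : seq {x | X x}, forall x y, x ≼[o] y ->
    (forall z, List.In z l -> z ≺[o] x \/ y ≺[o] z) -> (A (sval x) <-> A (sval y)).
Proof.
move=> [F [/finite_list[lF HF] intF ->]].
have [l Hl] : exists l : seq {x | X x}, forall x y, x ≼[o] y ->
    (forall z, List.In z l -> z ≺[o] x \/ y ≺[o] z) ->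
    forall B, List.In B lF -> F B -> (B (sval x) <-> B (sval y)).
  elim: lF {HF} => [|B lF [l Hl]]; first by exists [::].
  have [FB|nFB] := pselect (F B); last first.
    by exists l => x y xy H B' [<-//|]; exact: Hl.
  have [lB HB] : exists lB : seq {x | X x}, forall x y, x ≼[o] y ->
      (forall z, List.In z lB -> z ≺[o] x \/ y ≺[o] z) -> (B (sval x) <-> B (sval y)).
    case: (intF B FB) => [[a [b [Xa Xb ->]]]|[a Xa ->]]; last first.
      exists [:: exist X a Xa] => x y xy /(_ _ (or_introl erefl)) H.
      split=> E; exfalso.
        have Ex : x = exist X a Xa by exact: sval_inj.
        by rewrite -Ex in H; case: H => H; ord.
      have Ey : y = exist X a Xa by exact: sval_inj.
      by rewrite -Ey in H; case: H => H; ord.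
    have [la Hla] : exists la : seq {x | X x}, forall x y, x ≼[o] y ->
        (forall z, List.In z la -> z ≺[o] x \/ y ≺[o] z) ->
        (if a is Some a' then lt a' (sval x) else True) <->
        (if a is Some a' then lt a' (sval y) else True).
      case: a Xa => [a|] Xa; last by exists [::].
      exists [:: exist X a Xa] => x y xy /(_ _ (or_introl erefl)) H.
      pose a' : {x | X x} := exist X a Xa.
      change (a' ≺[o] x \/ y ≺[o] a') in H.
      change ((a' ≺[o] x) <-> (a' ≺[o] y)).
      by split=> ?; case: H => ?; ord.
    have [lb Hlb] : exists lb : seq {x | X x}, forall x y, x ≼[o] y ->
        (forall z, List.In z lb -> z ≺[o] x \/ y ≺[o] z) ->
        (if b is Some b' then lt (sval x) b' else True) <->
        (if b is Some b' then lt (sval y) b' else True).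
      case: b Xb => [b|] Xb; last by exists [::].
      exists [:: exist X b Xb] => x y xy /(_ _ (or_introl erefl)) H.
      pose b' : {x | X x} := exist X b Xb.
      change (b' ≺[o] x \/ y ≺[o] b') in H.
      change ((x ≺[o] b') <-> (y ≺[o] b')).
      by split=> ?; case: H => ?; ord.
    exists (la ++ lb)%list => x y xy H.
    have Ha := Hla x y xy (fun z zl => H z (List.in_or_app _ _ _ (or_introl zl))).
    have Hb := Hlb x y xy (fun z zl => H z (List.in_or_app _ _ _ (or_intror zl))).
    have Xx := proj2_sig x; have Xy := proj2_sig y.
    by split=> -[_ ? ?]; split=> //; tauto.
  exists (lB ++ l)%list => x y xy H B' [<- _|B'l FB'].
    by apply: HB => // z zl; apply: H; apply: List.in_or_app; left.
  by apply: Hl => // z zl; apply: H; apply: List.in_or_app; right.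
exists l => x y xy H; have {}Hl := Hl x y xy H.
by split=> -[B FB Bx]; exists B => //; apply/(Hl B (HF B FB) FB).
Qed.

Lemma list_finite_union (A : set U) (l : seq {x | X x}) : A `<=` X ->
  (forall x y, x ≼[o] y -> (forall z, List.In z l -> z ≺[o] x \/ y ≺[o] z) ->
    (A (sval x) <-> A (sval y))) ->
  finite_union_of_intervals_and_points X lt A.
Proof.
move=> AX Hl; pose L := [set x | exists2 z, List.In z l & x = sval z].
have finL : finite_set L.
  rewrite (_ : L = sval @` [set z | List.In z l]).
    by apply: finite_image; exact: (@list_finite _ _ l).
  by apply/seteqP; split=> x /= [z zl E]; exists z.
pose O := [set a : option U | if a is Some a' then L a' else True].
have finO : finite_set O.
  rewrite (_ : O = [set None] `|` Some @` L).
    by rewrite finite_setU; split; [exact: finite_set1|exact: finite_image].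
  by apply/seteqP; split=> [[a|] /= H|a /= [->//|[x Lx <-]]]; [right; exists a|left|].
(* All points of [l], and all intervals with end points in [l] or infinite, that lie inside [A]. A
   point of [A] off [l] is in the interval between its neighbours in [l]. *)
exists [set B | B `<=` A /\ ((exists a b, [/\ O a, O b & B = open_interval X lt a b])
  \/ (exists2 a, L a & B = [set a]))]; split.
- apply: (@sub_finite_set _ _ ((fun p => open_interval X lt p.1 p.2) @` (O `*` O)
      `|` (fun a => [set a]) @` L)).
    move=> B [_ [[a [b [Oa Ob ->]]]|[a La ->]]]; first by left; exists (a, b).
    by right; exists a.
  by rewrite finite_setU; split; apply: finite_image => //; exact: finite_setX.
- have LX a : L a -> X a by move=> [z _ ->]; exact: (proj2_sig z).
  move=> B [_ [[a [b [Oa Ob ->]]]|[a La ->]]]; [left|right].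
    exists a, b; split=> //; [case: a Oa|case: b Ob] => //= ?; exact: LX.
  by exists a => //; exact: LX.
- apply/seteqP; split=> x; last by move=> [B [BA _]]; exact: BA.
  move=> Ax; have Xx := AX x Ax; pose x' : {x | X x} := exist X x Xx.
  have [xl|xl] := pselect (List.In x' l).
    exists [set x]; last by [].
    by split=> [y ->//|]; right; exists x => //; exists x'.
  have [a [Oa ax amax]] : exists a, [/\ O a, if a is Some a' then lt a' x else True
      & forall z, List.In z l -> z ≺[o] x' ->
          exists2 m, a = Some (sval m) & z ≼[o] m].
    have [[z [zl zx]]|H] := pselect (exists z, List.In z l /\ z ≺[o] x').
      have [|m [[ml mx] Hm]] := @ex_max _ o l (fun z => List.In z l /\ z ≺[o] x') z _ (conj zl zx).
        by move=> ? [].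
      exists (Some (sval m)); split=> //; first by exists m.
      by move=> w wl wx; exists m => //; exact: Hm.
    by exists None; split=> // z zl zx; case: H; exists z.
  have [b [Ob xb bmin]] : exists b, [/\ O b, if b is Some b' then lt x b' else True
      & forall z, List.In z l -> x' ≺[o] z ->
          exists2 m, b = Some (sval m) & m ≼[o] z].
    have [[z [zl zx]]|H] := pselect (exists z, List.In z l /\ x' ≺[o] z).
      have [|m [[ml mx] Hm]] := @ex_min _ o l (fun z => List.In z l /\ x' ≺[o] z) z _ (conj zl zx).
        by move=> ? [].
      exists (Some (sval m)); split=> //; first by exists m.
      by move=> w wl wx; exists m => //; exact: Hm.
    by exists None; split=> // z zl zx; case: H; exists z.
  exists (open_interval X lt a b); last by split.
  split; last by left; exists a, b.
  move=> y [Xy ay yb]; pose y' : {x | X x} := exist X y Xy.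
  have notx z : List.In z l -> z <> x' by move=> zl E; apply: xl; rewrite -E.
  have lo z : List.In z l -> z ≺[o] x' -> z ≺[o] y'.
    move=> zl zx; have [m Ea zm] := amax z zl zx; move: ay; rewrite Ea => my.
    change (m ≺[o] y') in my; ord.
  have hi z : List.In z l -> x' ≺[o] z -> y' ≺[o] z.
    move=> zl zx; have [m Eb zm] := bmin z zl zx; move: yb; rewrite Eb => ym.
    change (y' ≺[o] m) in ym; ord.
  have [yx|xy] := pselect (y' ≺[o] x').
    apply/(Hl y' x') => // [|z zl]; first ord.
    by case: (olt_total o z x') (notx z zl) => [/(lo z zl)|//|]; [left|right].
  apply/(Hl x' y') => // z zl.
  by case: (olt_total o z x') (notx z zl) => [|//|/(hi z zl)]; [left|right].
Qed.

End FiniteUnions.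

(** * Sorts and chains from o-minimal sets *)

Section SubSorts.
Variables (T : Type) (D : defsys T).

Definition self_sort : sort D.
Proof. exists T id => [x|]; [by exists x | exact: dfn_eqvar]. Defined.

Variables (U : Type) (Q : set U) (q : T -> U).
Hypothesis Qq : forall x, Q (q x).
Hypothesis qK : forall c, Q c -> exists x, q x = c.

Definition sub_sort (qeq : @drel _ D self_sort self_sort (fun x y => q x = q y)) :
  sort D.
Proof.
exists {c | Q c} (fun x => exist Q (q x) (Qq x)) => [[c Qc]|].
  by have [x E] := qK Qc; exists x; exact: sval_inj.
apply: dfn_ext qeq => v; split=> [E|/(congr1 (@sval _ _))//].
exact: sval_inj.
Defined.

Variables (lt : U -> U -> Prop) (Def : set (set U)).
Hypothesis qeq : @drel _ D self_sort self_sort (fun x y => q x = q y).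
Hypothesis qlt : @drel _ D self_sort self_sort (fun x y => lt (q x) (q y)).
Hypothesis denseQ : dense_order Q lt.
Hypothesis ominQ : o_minimal Def Q lt.
Hypothesis DefP : forall A : set U, A `<=` Q ->
  @dset _ D self_sort (fun x => A (q x)) -> Def A.

Let linQ : linear_order_on Q lt. Proof. by case: ominQ. Qed.

Let sub_chain_def : @drel _ _ (sub_sort qeq) (sub_sort qeq) (olt (sub_order linQ)).
Proof. by apply: dfn_ext qlt => v. Qed.

Let sub_chain_dense (x y : {c | Q c}) : x ≺[sub_order linQ] y ->
  exists z, x ≺[sub_order linQ] z /\ z ≺[sub_order linQ] y.
Proof.
case: x y => [x Qx] [y Qy] /= xy; have [z [Qz xz zy]] := denseQ Qx Qy xy.
by exists (exist Q z Qz).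
Qed.

Let sub_chain_omin (A : {c | Q c} -> Prop) : @dset _ _ (sub_sort qeq) A ->
  exists l : seq {c | Q c}, forall x y, x ≼[sub_order linQ] y ->
    (forall z, List.In z l -> z ≺[sub_order linQ] x \/ y ≺[sub_order linQ] z) ->
    (A x <-> A y).
Proof.
move=> dA; pose A' := [set c | exists H : Q c, A (exist Q c H)].
have A'q x : A' (q x) <-> A (exist Q (q x) (Qq x)).
  split=> [[H]|H]; last by exists (Qq x).
  by rewrite (Prop_irrelevance H (Qq x)).
have [|l Hl] := @finite_union_list _ Q lt linQ A'.
  case: ominQ => _ _; apply; last by move=> c [].
  apply: DefP; first by move=> c [].
  by apply: dfn_ext dA => v; rewrite A'q.
have A's (c : {c | Q c}) : A' (sval c) <-> A c.
  case: c => c Qc /=; split=> [[H]|H]; last by exists Qc.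
  by rewrite (Prop_irrelevance H Qc).
by exists l => x y xy H; rewrite -!A's; exact: Hl.
Qed.

(** Serves both kinds of o-minimal sets in a decomposition: [U] consists of tuples for the last
    classes and of sets of tuples for the quotients, with [Def] the matching definability. *)
Definition sub_chain : chain D :=
  @Chain T D (sub_sort qeq) (sub_order linQ)
    sub_chain_def sub_chain_dense sub_chain_omin.

Lemma sub_chain_code x y : code sub_chain x = code sub_chain y -> q x = q y.
Proof.
move=> E; have {}E : code (sub_sort qeq) x = code (sub_sort qeq) y := E.
exact: (congr1 (fun c : {c | Q c} => sval c) E).
Qed.

End SubSorts.

(** * Definable sets, relations and operations on tuples *)

Section Structures.
Variables (L : signature) (C : structure L) (k : nat).
Hypothesis k_gt0 : 0 < k.
Variable c0 : C.
Local Notation T := (k.-tuple C).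
Let D := @formula_defsys L C k k_gt0 c0.
Let S := self_sort D.
Implicit Types (X : set T).

Lemma definable_dset X : definable X <-> dset (X : S -> Prop).
Proof. exact: definable_fdfn. Qed.

Lemma definable_concat m (Z : set (m.-tuple C)) (w : (nat -> T) -> m.-tuple C) :
  (forall v c i, i < m -> nth c (w v) i = nth c (v (i %/ k)) (i %% k)) ->
  definable Z -> dfn D (fun v => Z (w v)).
Proof.
move=> Hw [phi [s ->]].
apply: (@sat_fdfn _ _ _ k_gt0 m phi s (fun v i => nth c0 (w v) i)) => [v i im|v /=].
  by rewrite Hw // (flat_nth k_gt0 c0).
suff -> : assign s (w v) = fun i => if i < m then nth c0 (w v) i else s i by [].
apply/funext => i; rewrite /assign; case: ltnP => im.
  by apply: set_nth_default; rewrite size_tuple.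
by rewrite nth_default // size_tuple.
Qed.

Lemma cat_tuple_inj m n (x x' : m.-tuple C) (y y' : n.-tuple C) :
  [tuple of x ++ y] = [tuple of x' ++ y'] -> x = x' /\ y = y'.
Proof.
move=> /(congr1 val) /= E.
split; apply: val_inj.
  by have := congr1 (take m) E; rewrite !take_size_cat ?size_tuple.
by have := congr1 (drop m) E; rewrite !drop_size_cat ?size_tuple.
Qed.

Lemma divn_modn_block a i : a * k <= i -> i - a * k < k ->
  i %/ k = a /\ i %% k = i - a * k.
Proof.
move=> ai ik; have E : i = a * k + (i - a * k) by rewrite subnKC.
by rewrite E divnMDl // modnMDl addKn divn_small // modn_small // addn0.
Qed.

Lemma definable_rel_drel X (R : T -> T -> Prop) : definable_rel X R ->
  drel (fun x y : S => X x /\ X y /\ R x y).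
Proof.
move=> /(@definable_concat _ _ (fun v => [tuple of v 0 ++ v 1])) H.
apply: dfn_ext (H _) => [v|v c i ik].
  split=> [[x [y [Xx Xy Rxy /cat_tuple_inj[-> ->]]]]//|[? [? ?]]].
  by exists (v 0), (v 1).
rewrite /= nth_cat size_tuple; case: ltnP => ki.
  by rewrite divn_small // modn_small.
have [||-> ->] := @divn_modn_block 1 i; rewrite mul1n //.
by rewrite ltn_subLR.
Qed.

Lemma definable_op_drel X (op : T -> T -> T) : definable_op X op ->
  drel3 (fun z x y : S => X x /\ X y /\ z = op x y).
Proof.
move=> /(@definable_concat _ _ (fun v => [tuple of (v 0 ++ v 1) ++ v 2])) H.
have H' : drel3 (fun x y z : S => X x /\ X y /\ z = op x y).
  apply: dfn_ext (H _) => [v|v c i ik].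
    split=> [[x [y [Xx Xy /cat_tuple_inj[/cat_tuple_inj[-> ->] ->]]]]//|[? [? E]]].
    by exists (v 0), (v 1); split=> //; rewrite -E.
  rewrite /= nth_cat size_cat !size_tuple nth_cat size_tuple.
  case: ltnP => kki.
    case: ltnP => ki; first by rewrite divn_small // modn_small.
    have [||-> ->] := @divn_modn_block 1 i; rewrite mul1n //.
    by rewrite ltn_subLR.
  have [||-> ->] := @divn_modn_block 2 i; rewrite mul2n -addnn //.
  by rewrite ltn_subLR.
pose R (x y z : S) := X x /\ X y /\ z = op x y.
have dR : drel3 R by exact: H'.
suff : drel3 (fun z x y : S => R x y z) by [].
by definable.
Qed.

End Structures.

(** If the conjugate [W] lies in [V], minimality gives the reverse inclusion. Otherwise some
    positive [w] of [W] lies above all of [V], and convexity of [W] gives it. *)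
Lemma minimal_normal (T : Type) (D : defsys T) (G : ogroup D) (V : G -> Prop) g h :
  minimal V -> V h -> V (g ⋅ h ⋅ g^^-1).
Proof.
move=> [cV ntV mV] Vh; pose W x := V (g ⋅ x ⋅ g^^-1).
have dV := csub_def cV.
have gK x : g ⋅ (g^^-1 ⋅ x ⋅ g) ⋅ g^^-1 = x.
  by rewrite -gmulA gmulA -(gmulA g^^-1) gmulKVg gmulgK.
have cW : csub W.
  split.
  - by rewrite /W; definable.
  - by rewrite /W gmulg1 gmulgV; exact: csub1.
  - move=> x y Wx Wy; have := csubM cV Wx Wy.
    by rewrite /W !gmulA gmulgKV.
  - by move=> x /(csubV cV); rewrite /W !ginvM ginvK gmulA.
  - move=> x y z Wx Wz xy yz; apply: (csub_convex cV Wx Wz).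
      by rewrite gltr_iff gltl_iff.
    by rewrite gltr_iff gltl_iff.
suff : forall x, V x -> W x by exact.
have [WV|/existsNP[x /not_implyP[Wx nVx]]] := pselect (forall x, W x -> V x).
  apply: mV => //; have [v [Vv v1]] := ntV; exists (g^^-1 ⋅ v ⋅ g).
  split; first by rewrite /W gK.
  by move=> E1; apply: v1; rewrite -(gK v) E1 gmulg1 gmulgV.
have [w [Ww nVw wp]] : exists w, [/\ W w, ~ V w & gone ≺[G] w].
  case: (olt_total G x gone) => [xn|E1|xp]; last by exists x.
    exists x^^-1; split; first exact: (csubV cW).
      by move/(csubV cV); rewrite ginvK.
    by rewrite -(gltl_iff _ _ x) gmulg1 gmulgV.
  by case: nVx; rewrite E1; exact: (csub1 cV).
have Vw v : V v -> v ≺[G] w.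
  move=> Vv; apply: contrapT => vw; apply: nVw.
  by apply: (csub_convex cV (csub1 cV) Vv) => //; ord.
move=> v Vv; apply: (csub_convex cW (csubV cW Ww) Ww); apply: oltW.
  by rewrite -(ginvK v) gltV; apply: Vw; exact: (csubV cV).
exact: Vw.
Qed.

(** * The decomposed group as an abstract ordered group with a tower *)

Section Transfer.
Variables (L : signature) (C : structure L) (k : nat).
Hypothesis k_gt0 : 0 < k.
Variable c0 : C.
Local Notation T := (k.-tuple C).
Let D := @formula_defsys L C k k_gt0 c0.
Let S := self_sort D.
Implicit Types (X : set T) (w x y : T).

(** The coding map of a sort is total on tuples, so those outside [X] are sent to a base point. *)
Definition retract X w x := if pselect (X x) then x else w.

Lemma retractP X w x : X w -> X (retract X w x).
Proof. by rewrite /retract; case: pselect. Qed.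

Lemma retract_id X w x : X x -> retract X w x = x.
Proof. by rewrite /retract; case: pselect. Qed.

Lemma retract_def X w : dset (X : S -> Prop) ->
  drel (fun y x : S => y = retract X w x).
Proof.
move=> dX; have dX' : @dset _ D S X := dX.
suff : drel (fun y x : S => X x /\ y = x \/ ~ X x /\ y = (w : S)).
  apply: dfn_ext => v; move: (code S (v 0)) (code S (v 1)) => y x.
  by rewrite /retract; case: pselect => ?; split; [case=> -[]|left|case=> -[]|right].
by definable.
Qed.

Variables (G : set T) (lt : T -> T -> Prop) (mul : T -> T -> T) (e : T) (inv : T -> T).
Hypotheses (defG : definable G) (deflt : definable_rel G lt) (defmul : definable_op G mul).
Hypothesis ogG : ordered_group_on G lt mul e inv.

Let grG := ogrp_group ogG.
Let linG := ogrp_order ogG.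

Let dG : @dset _ D S G. Proof. exact/definable_dset. Qed.

Let Gr x : G (retract G e x). Proof. by apply: retractP; exact: grp_one grG. Qed.

Let retract_eq X w : @dset _ D S X ->
  @drel _ D S S (fun x y => retract X w x = retract X w y).
Proof.
move=> dX; pose r : S -> S := retract X w.
have dr : @drel _ D S S (fun y x => y = r x) := retract_def w dX.
suff : @drel _ D S S (fun x y => r x = r y) by [].
by definable.
Qed.

Definition group_sort : sort D.
Proof.
apply: (@sub_sort _ D T G (retract G e) Gr) (retract_eq e dG) => x Gx.
by exists x; exact: retract_id.
Defined.

Let val (a : group_sort) : S := sval a.
Let valG (a : group_sort) : G (val a) := proj2_sig a.
Let val_def : @drel _ D S group_sort (fun y a => y = val a). Proof. exact: (retract_def e dG). Qed.

Definition group_mul (a b : group_sort) : group_sort :=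
  exist G (mul (val a) (val b)) (grp_mul grG (valG a) (valG b)).
Definition group_one : group_sort := exist G e (grp_one grG).
Definition group_inv (a : group_sort) : group_sort :=
  exist G (inv (val a)) (grp_inv grG (valG a)).

Let group_mul_def : drel3 (fun c a b => c = group_mul a b).
Proof.
have := definable_op_drel k_gt0 c0 defmul.
pose R (z x y : S) := G x /\ G y /\ z = mul x y.
rewrite -[drel3 _]/(drel3 R) => dR.
have : drel3 (fun c a b => R (val c) (val a) (val b)) by definable.
apply: dfn_ext => v; move: (code _ _) (code _ _) (code _ _) => c a b.
split=> [[_ [_ E1]]|->]; first exact: sval_inj.
by split; [|split].
Qed.

(** The equation [group_mul a b = group_one] cuts out the graph of the inverse, which thus inherits
    definability from the multiplication. *)
Let group_inv_def : drel (fun b a => b = group_inv a).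
Proof.
have dm := group_mul_def.
have : drel (fun b a => group_mul a b = group_one) by definable.
apply: dfn_ext => v; move: (code _ _) (code _ _) => b a.
split=> [/(congr1 (@sval _ _)) /= E1|->]; apply: sval_inj => /=.
  have Gb := valG b; have Ga := valG a.
  rewrite -[LHS](grp_mul1 grG Gb).1 -(grp_mulV grG Ga).1.
  rewrite -(grp_assoc grG (grp_inv grG Ga) Ga Gb) E1.
  exact: (grp_mul1 grG (grp_inv grG Ga)).2.
exact: (grp_mulV grG (valG a)).2.
Qed.

Definition group_of : ogroup D.
Proof.
apply: (@OGroup _ D group_sort (sub_order linG) group_mul group_one group_inv).
- have := definable_rel_drel k_gt0 c0 deflt.
  pose R (x y : S) := G x /\ G y /\ lt x y.
  rewrite -[drel _]/(drel R) => dR.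
  have : drel (fun a b => R (val a) (val b)) by definable.
  apply: dfn_ext => v; move: (code _ _) (code _ _) => a b.
  by split=> [[_ []]|?]; last by split; [|split].
- exact: group_mul_def.
- exact: group_inv_def.
- by move=> a b c; apply: sval_inj; apply: (grp_assoc grG).
- by move=> a; apply: sval_inj; exact: (grp_mul1 grG (valG a)).1.
- by move=> a; apply: sval_inj; exact: (grp_mul1 grG (valG a)).2.
- by move=> a; apply: sval_inj; exact: (grp_mulV grG (valG a)).1.
- by move=> a; apply: sval_inj; exact: (grp_mulV grG (valG a)).2.
- by move=> a b c; apply: (ogrp_left ogG).
- by move=> a b c; apply: (ogrp_right ogG).
Defined.

Variables (n : nat) (E : nat -> T -> T -> Prop) (ltq : nat -> set T -> set T -> Prop).
Hypothesis decG : decomposition G lt n E ltq.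

Lemma class_eq i x y : i <= n -> G x -> G y ->
  class_of G (E i) x = class_of G (E i) y <-> E i x y.
Proof.
move=> i_n Gx Gy; have eqE := dec_eqv decG i_n; split=> [H|Exy].
  have : class_of G (E i) x x by split=> //; exact: (eqv_refl eqE).
  by rewrite H => -[].
apply/seteqP; split=> z [Gz Ez]; split=> //; apply: (eqv_trans eqE) Ez _ => //.
exact: (eqv_sym eqE).
Qed.

Let RE i (x y : S) := G x /\ G y /\ E i x y.
Let dRE i : i <= n -> drel (RE i).
Proof. by move=> i_n; exact: definable_rel_drel (dec_def decG i_n). Qed.

Let class_dset i w : i <= n -> G w -> @dset _ D S (class_of G (E i) w).
Proof.
move=> i_n Gw; have dR := dRE i_n.
pose w' : S := w; have H : dset (fun x : S => RE i x w') by definable.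
by apply: dfn_ext H => v; split=> [[? [_ ?]]|[? ?]]; split.
Qed.

Let class_refl i w : i <= n -> G w -> class_of G (E i) w w.
Proof. by move=> i_n Gw; split=> //; exact: (eqv_refl (dec_eqv decG i_n)). Qed.

Lemma quotient_chain i w : i < n -> G w -> exists J : chain D,
  forall x y, class_of G (E i) w x -> class_of G (E i) w y ->
  code J x = code J y -> E i.+1 x y.
Proof.
move=> i_n Gw; have i_n' := ltnW i_n.
pose X := class_of G (E i) w.
have Xw : X w by exact: class_refl.
have dX : @dset _ D S X by exact: class_dset.
have XG x : X x -> G x by case.
pose r : S -> S := retract X w.
have dr : @drel _ D S S (fun y x => y = r x) := retract_def w dX.
have Xr x : X (r x) by exact: retractP.
pose q x := class_of G (E i.+1) (r x).
have [dns omn] := dec_quotient decG i_n Gw.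
have Qq x : (class_of G (E i.+1) @` X) (q x) by exists (r x).
have qK c : (class_of G (E i.+1) @` X) c -> exists x, q x = c.
  by move=> [x Xx <-]; exists x; rewrite /q /r retract_id.
have qeq : @drel _ D S S (fun x y => q x = q y).
  have dR := dRE i_n; have : @drel _ D S S (fun x y => RE i.+1 (r x) (r y)) by definable.
  apply: dfn_ext => v; rewrite class_eq //; [|exact: XG..].
  by split=> [[_ []]|?] //; split; [|split] => //; exact: XG.
have qlt : @drel _ D S S (fun x y => ltq i (q x) (q y)).
  have := definable_rel_drel k_gt0 c0 (dec_ltq_def decG i_n).
  pose R (x y : S) := G x /\ G y /\
    ltq i (class_of G (E i.+1) x) (class_of G (E i.+1) y).
  rewrite -[drel _]/(drel R) => dR.
  have : @drel _ D S S (fun x y => R (r x) (r y)) by definable.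
  by apply: dfn_ext => v; split=> [[_ []]|?] //; split; [|split] => //; exact: XG.
have DefP A : A `<=` class_of G (E i.+1) @` X ->
    @dset _ D S (fun x => A (q x)) -> @definable_classes L C k A.
  move=> AQ; pose B (x : S) := A (q x); rewrite -[dset _]/(dset B) => dB.
  apply/(definable_dset k_gt0 c0).
  have : dset (fun x : S => X x /\ B x) by definable.
  (* [definable_classes] speaks of the union of the classes in [A]: the [x] in [X] with [q x] in
     [A]. *)
  rewrite (_ : (fun x => X x /\ B x) = \bigcup_(c in A) c) //.
  apply/seteqP; split=> x.
    move=> [Xx]; rewrite /B /q /r retract_id // => Ax.
    by exists (class_of G (E i.+1) x) => //; apply: class_refl => //; exact: XG.
  move=> [c Ac cx]; have [y Xy cE] := AQ c Ac.
  move: cx; rewrite -cE => -[Gx Exy]; have Gy := XG y Xy.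
  have Xx : X x.
    split=> //; apply: (eqv_trans (dec_eqv decG i_n')) (proj2 Xy) => //.
    exact: (dec_refine decG i_n).
  split=> //; rewrite /B /q /r retract_id //.
  by rewrite (_ : class_of _ _ x = c) // -cE; apply/class_eq.
exists (sub_chain Qq qK qeq qlt dns omn DefP) => x y Xx Xy.
move=> Exy; move: (sub_chain_code Exy); rewrite /q /r !retract_id // => /class_eq; apply=> //.
  exact: XG.
exact: XG.
Qed.

Lemma class_chain w : G w -> exists J : chain D,
  forall x y, class_of G (E n) w x -> class_of G (E n) w y ->
  code J x = code J y -> x = y.
Proof.
move=> Gw; pose X := class_of G (E n) w.
have Xw : X w by exact: class_refl.
have dX : @dset _ D S X by exact: class_dset.
have XG x : X x -> G x by case.
pose r : S -> S := retract X w.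
have dr : @drel _ D S S (fun y x => y = r x) := retract_def w dX.
have Xr x : X (r x) by exact: retractP.
have [dns omn] := dec_class decG Gw.
have rK c : X c -> exists x, r x = c by move=> Xc; exists c; exact: retract_id.
have rlt : @drel _ D S S (fun x y => lt (r x) (r y)).
  have := definable_rel_drel k_gt0 c0 deflt.
  pose R (x y : S) := G x /\ G y /\ lt x y.
  rewrite -[drel _]/(drel R) => dR.
  have : @drel _ D S S (fun x y => R (r x) (r y)) by definable.
  by apply: dfn_ext => v; split=> [[_ []]|?] //; split; [|split] => //; exact: XG.
have DefP A : A `<=` X -> @dset _ D S (fun x => A (r x)) -> @definable L C k A.
  move=> AX; pose B (x : S) := A (r x); rewrite -[dset _]/(dset B) => dB.
  apply/(definable_dset k_gt0 c0).
  have : dset (fun x : S => X x /\ B x) by definable.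
  rewrite (_ : (fun x => X x /\ B x) = A) //.
  apply/seteqP; split=> x; first by move=> [Xx]; rewrite /B /r retract_id.
  by move=> Ax; have Xx := AX x Ax; split=> //; rewrite /B /r retract_id.
exists (sub_chain Xr rK (retract_eq w dX) rlt dns omn DefP) => x y Xx Xy.
by move=> Exy; move: (sub_chain_code Exy); rewrite /r !retract_id.
Qed.

(** The arguments are swapped because [class_of] puts the representative second; level [n.+1] is
    equality. *)
Let E' i (w x : group_of) :=
  if i <= n then E i (val x) (val w) else w = x.

Lemma group_tower : tower n E'.
Proof.
split.
- move=> i i_n; have dR := dRE i_n.
  have H : drel (fun w x : group_of => RE i (val x) (val w)) by definable.
  apply: dfn_ext H => v; rewrite /E' i_n; split=> [[_ []]//|Exw].
  by split; first exact: valG; split; first exact: valG.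
- have [l Hl] := finite_list (dec_finite decG).
  have [l' Hl'] := choice_list (fun c (w : group_of) => c = class_of G (E 0) (val w)) l.
  exists l' => x; have Gx := valG x.
  have [||w [wl Ew]] := Hl' (class_of G (E 0) (val x)).
  + by apply: Hl; exists (val x).
  + by exists x.
  exists w; split=> //; rewrite /E' leq0n; apply/class_eq => //; exact: valG.
- by move=> x y; rewrite /E' ltnn.
- move=> i w i_n; have Gw := valG w.
  suff [J HJ] : exists J : chain D, forall x y : group_of,
      class_of G (E i) (val w) (val x) -> class_of G (E i) (val w) (val y) ->
      code J (val x) = code J (val y) -> E' i.+1 x y.
    exists J, (fun x : group_of => code J (val x)); split.
      pose F : S -> J := code J.
      have dF : @drel _ D J S (fun t x => t = F x) := code_eq J.
      suff : drel (fun t (x : group_of) => t = F (val x)) by [].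
      by definable.
    move=> x y; rewrite /E' i_n => Ex Ey; apply: HJ; split=> //; exact: valG.
  have [i_n'|n_i] := ltnP i n.
    have [J HJ] := quotient_chain i_n' Gw; exists J => x y Xx Xy Exy.
    rewrite /E' i_n'; apply: HJ => //.
  have Ei : i = n by apply/eqP; rewrite eqn_leq i_n.
  rewrite Ei in Gw *; have [J HJ] := class_chain Gw; exists J => x y Xx Xy Exy.
  by rewrite /E' ltnn; apply: sval_inj; exact: HJ.
Qed.

Lemma transfer : infinite_set G -> exists H : set T,
  [/\ infinite_set H, convex_in G lt H, normal_subgroup_of G mul e inv H,
    definable H & o_minimal (@definable L C k) H lt].
Proof.
move=> infG.
have [|V minV] := @minimal_csub _ _ group_of n E' group_tower.
  apply: contrapT => H; apply: infG; apply: (@list_finite _ _ [:: e]) => x Gx.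
  left; apply: contrapT => ex; apply: H; exists (exist G x Gx).
  by move=> /(congr1 (@sval _ _)) /= xe; apply: ex.
have {}minV : minimal V by case: minV.
have [cV _ _] := minV.
pose H := [set x | exists Gx : G x, V (exist G x Gx)].
have HG : H `<=` G by move=> x [].
have HV (a : group_of) : H (val a) <-> V a.
  split=> [[Ga]|Va]; last by exists (valG a); case: a Va.
  by rewrite (_ : exist _ _ _ = a) //; exact: sval_inj.
have dH : dset (H : S -> Prop).
  have dV := csub_def cV; pose r : S -> group_of := code group_of.
  have dr : @drel _ D group_of S (fun a s => a = r s) := code_eq group_of.
  have : dset (fun x : S => (G : S -> Prop) x /\ V (r x)) by definable.
  apply: dfn_ext => v; split=> [[Gv Vv]|[Gv Vv]].
    by exists Gv; rewrite (_ : exist _ _ _ = r (v 0)) //; apply: sval_inj; rewrite /= retract_id.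
  by split=> //; rewrite (_ : r _ = exist G _ Gv) //; apply: sval_inj; rewrite /= retract_id.
have defH : definable H by exact/(definable_dset k_gt0 c0).
exists H; split=> //.
- move=> /finite_list[l Hl].
  apply: (minimal_infinite minV).
  have [l' Hl'] := fin_image (r := fun x (a : group_of) => x = val a) l
    (fun x a b Ea Eb => sval_inj (etrans (esym Ea) Eb)).
  by exists l' => a /HV/Hl ?; exact: (Hl' (val a)).
- move=> x y z [Gx Vx] Gy [Gz Vz] xy yz; exists Gy.
  apply: (csub_convex cV Vx Vz); exact: (@oltW _ (gord group_of)).
- split; first split=> //.
  + by exists (grp_one grG); exact: csub1 cV.
  + move=> x y [Gx Vx] [Gy Vy].
    exact: (HV (group_mul (exist G x Gx) (exist G y Gy))).2 (csubM cV Vx Vy).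
  + move=> x [Gx Vx].
    exact: (HV (group_inv (exist G x Gx))).2 (csubV cV Vx).
  + move=> g h Gg [Gh Vh].
    have := minimal_normal (exist G g Gg : group_of) minV Vh.
    exact: (HV (group_mul (group_mul (exist G g Gg) (exist G h Gh))
      (group_inv (exist G g Gg)))).2.
have linH : linear_order_on H lt.
  split=> [x /HG|x y z /HG Gx /HG Gy /HG Gz|x y /HG Gx /HG Gy].
  - exact: (lin_irr linG).
  - exact: (lin_trans linG).
  - exact: (lin_total linG).
split=> // A defA AH.
have dA : @dset _ D S A by exact/definable_dset.
have dA' : dset (fun a : group_of => A (val a)) by definable.
have [|l Hl] := minimal_ominimal group_tower minV dA'.
  by move=> a /AH/HV.
have [l' Hl'] := choice_list (fun (a : group_of) (b : {x | H x}) => val a = sval b) l.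
apply: (@list_finite_union _ H lt linH A l') => // x y xy Hxy.
have [Gx Vx] := proj2_sig x; have [Gy Vy] := proj2_sig y.
apply: (Hl (exist G _ Gx) (exist G _ Gy) Vx Vy xy) => z zl.
apply: contrapT => nz; have Vz : V z.
  by apply: (csub_convex cV Vx Vy) => ?; apply: nz; [left|right].
have [|b [bl zb]] := Hl' z zl; first by exists (exist H (val z) ((HV z).2 Vz)).
by apply: nz; have := Hxy b bl; rewrite /= -zb.
Qed.


End Transfer.

Theorem theorem2p8 (L : signature) (C : structure L) (k : nat)
    (G : set (k.-tuple C)) (lt : k.-tuple C -> k.-tuple C -> Prop)
    (mul : k.-tuple C -> k.-tuple C -> k.-tuple C)
    (e : k.-tuple C) (inv : k.-tuple C -> k.-tuple C) :
  definable G -> definable_rel G lt -> definable_op G mul ->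
  ordered_group_on G lt mul e inv ->
  infinite_set G ->
  decomposable G lt ->
  exists H : set (k.-tuple C),
    [/\ infinite_set H,
        convex_in G lt H,
        normal_subgroup_of G mul e inv H,
        definable H
      & o_minimal (@definable L C k) H lt].
Proof.
move=> defG deflt defmul ogG infG decG.
case: decG => [//|[n [E [ltq decG]]]].
(* For [k = 0] there is a single tuple, so [G] would be finite. *)
have k_gt0 : 0 < k.
  case: (posnP k) => // k0; case: infG; apply: (@list_finite _ _ [:: e]) => x _.
  left; apply: val_inj; have sz (y : k.-tuple C) : val y = [::].
    by apply: size0nil; rewrite size_tuple.
  by rewrite !sz.
exact: (transfer k_gt0 (tnth e (Ordinal k_gt0)) defG deflt defmul ogG decG).
Qed.
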